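(* Suppose that the number $s$ of resources and the number $|\mathcal{T}|$ of distinct job release dates are constants (fixed, not part of the input). Then the problem $1|jrp,r_j|\sum w_jC_j+c_\mathcal{Q}$ is equivalent to the classical single machine scheduling problem $1|r_j|\sum w_jC_j$.
   Context: Problem $1|jrp,r_j|c_S+c_\mathcal{Q}$: a set $\mathcal{J}$ of $n$ jobs must be processed non-preemptively on a single machine that processes at most one job at a time. Job $j$ has processing time $p_j>0$, release date $r_j\ge 0$ and weight $w_j>0$. There are resources $\mathcal{R}=\{R_1,\dots,R_s\}$, and each job $j$ requires a nonempty subset $R(j)\subseteq\mathcal{R}$. There are nonnegative costs $K_0,K_1,\dots,K_s$. A solution is a pair $(S,\mathcal{Q})$, where $S$ assigns a start time $S_j$ to each job (completion time $C_j=S_j+p_j$), and $\mathcal{Q}=\{(\mathcal{R}_1,t_1),\dots,(\mathcal{R}_q,t_q)\}$ is a replenishment structure with time points $t_1<\dots<t_q$ and subsets $\mathcal{R}_\ell\subseteq\mathcal{R}$ (the resources of $\mathcal{R}_\ell$ are replenished at time $t_\ell$). Job $j$ is ready to be started at time $t$ if $R(j)\subseteq\bigcup_{\ell:\,t_\ell\in[r_j,t]}\mathcal{R}_\ell$. The solution is feasible if no two jobs overlap in time and each job $j$ is ready to be started at $S_j$. The replenishment cost is $c_\mathcal{Q}=\sum_{\ell=1}^{q}(K_0+\sum_{R_i\in\mathcal{R}_\ell}K_i)$, and the goal is to minimize $\sum_j w_jC_j+c_\mathcal{Q}$ over feasible solutions. $\mathcal{T}$ denotes the set of distinct values among the release dates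 $r_j$. The problem $1|r_j|\sum w_jC_j$ is: schedule the jobs non-preemptively on a single machine, each job starting no earlier than its release date, minimizing $\sum_j w_jC_j$. Two optimization problems $A$ and $B$ are called equivalent if an optimal solution of $A$ can be obtained in polynomial time using an oracle that solves $B$ optimally in constant time (with the instances passed to the oracle prepared in time polynomial in the size of the instance of $A$), and vice versa. *)

(* Defs.v *)
From HB Require Import structures.
From mathcomp Require Import all_boot all_order all_algebra.
Set Implicit Arguments.
Unset Strict Implicit.
Unset Printing Implicit Defensive.
Import Order.TTheory GRing.Theory Num.Theory.
Local Open Scope ring_scope.

(** * Model of computation

  Algorithms are programs of a WHILE language over S-expressions with rational
  atoms.  Polynomial time in this model is polynomial time on Turing machines:
  - numbers have their binary size, and arithmetic and comparison are charged
    the binary sizes of operands and result (logarithmic cost);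
  - building and taking apart pairs costs one unit (pointer manipulation);
  - since pairs can share subterms, the length of a value written out in full
    is charged when the value is passed to the oracle or output as the result;
  - the oracle itself answers in one unit of time. *)

Inductive data := Nil | Num of rat | Pair of data & data.

Definition bits (m : nat) : nat := (trunc_log 2 m).+1.

Definition rat_size (q : rat) : nat := (bits `|numq q| + bits `|denq q|)%N.

Fixpoint data_size (d : data) : nat :=
  match d with
  | Nil => 1%N
  | Num q => (rat_size q).+1%N
  | Pair a b => (data_size a + data_size b).+1%N
  end.

Inductive binop := Add | Sub | Mul | Div | Le.

Inductive expr :=
  | Var of nat
  | Const of data
  | MkPair of expr & expr
  | Fst of expr
  | Snd of expr
  | IsPair of expr
  | Op of binop & expr & expr.

(* In tests, [Nil] is false and every other value is true. *)
Inductive cmd :=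
  | Skip
  | Assign of nat & expr
  | Seq of cmd & cmd
  | If of expr & cmd & cmd
  | While of expr & cmd
  | Query of nat & expr.

Definition store := nat -> data.

Definition upd (m : store) (x : nat) (d : data) : store :=
  fun y => if y == x then d else m y.

Definition truth (d : data) : bool := if d is Nil then false else true.
Definition of_bool (b : bool) : data := if b then Num 1 else Nil.
Definition to_rat (d : data) : rat := if d is Num q then q else 0.

Definition binop_eval (o : binop) (a b : rat) : data :=
  match o with
  | Add => Num (a + b)
  | Sub => Num (a - b)
  | Mul => Num (a * b)
  | Div => Num (a / b)
  | Le => of_bool (a <= b)
  end.

Fixpoint eval (m : store) (e : expr) : data :=
  match e with
  | Var x => m x
  | Const d => d
  | MkPair e1 e2 => Pair (eval m e1) (eval m e2)
  | Fst e1 => if eval m e1 is Pair a _ then a else Nil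
  | Snd e1 => if eval m e1 is Pair _ b then b else Nil
  | IsPair e1 => of_bool (if eval m e1 is Pair _ _ then true else false)
  | Op o e1 e2 => binop_eval o (to_rat (eval m e1)) (to_rat (eval m e2))
  end.

Fixpoint eval_time (m : store) (e : expr) : nat :=
  match e with
  | Var _ | Const _ => 1%N
  | MkPair e1 e2 => (eval_time m e1 + eval_time m e2).+1%N
  | Fst e1 | Snd e1 | IsPair e1 => (eval_time m e1).+1%N
  | Op o e1 e2 =>
      (eval_time m e1 + eval_time m e2
       + rat_size (to_rat (eval m e1)) + rat_size (to_rat (eval m e2))
       + data_size (eval m (Op o e1 e2))).+1%N
  end.

(* [exec O c m t m']: with oracle [O], running [c] from the store [m]
   terminates after [t] time units in the store [m']. *)
Inductive exec (O : data -> data) : cmd -> store -> nat -> store -> Prop :=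
  | ExecSkip m : exec O Skip m 1%N m
  | ExecAssign m x e :
      exec O (Assign x e) m (eval_time m e).+1%N (upd m x (eval m e))
  | ExecSeq m1 m2 m3 c1 c2 t1 t2 :
      exec O c1 m1 t1 m2 -> exec O c2 m2 t2 m3 ->
      exec O (Seq c1 c2) m1 (t1 + t2).+1%N m3
  | ExecIf m m' e c1 c2 t :
      exec O (if truth (eval m e) then c1 else c2) m t m' ->
      exec O (If e c1 c2) m (eval_time m e + t).+1%N m'
  | ExecWhileEnd m e c :
      ~~ truth (eval m e) -> exec O (While e c) m (eval_time m e).+1%N m
  | ExecWhileStep m1 m2 m3 e c t1 t2 :
      truth (eval m1 e) ->
      exec O c m1 t1 m2 -> exec O (While e c) m2 t2 m3 ->
      exec O (While e c) m1 (eval_time m1 e + t1 + t2).+1%N m3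
  | ExecQuery m x e :
      exec O (Query x e) m (eval_time m e + data_size (eval m e)).+1%N
        (upd m x (O (eval m e))).

(* Input and output are passed in variable 0; [t] includes the time for
   writing out the result. *)
Definition computes (O : data -> data) (c : cmd) (input : data) (t : nat)
    (output : data) : Prop :=
  exists t0 m,
    [/\ exec O c (upd (fun=> Nil) 0%N input) t0 m, m 0%N = output
      & t = (t0 + data_size output)%N].

(** * Optimization problems and their equivalence *)

Record optproblem := OptProblem {
  raw_instance : Type;
  is_instance : raw_instance -> Prop;
  solution : raw_instance -> Type;
  feasible : forall I : raw_instance, solution I -> Prop;
  cost : forall I : raw_instance, solution I -> rat;
  enc_instance : raw_instance -> data;
  enc_solution : forall I : raw_instance, solution I -> data
}.

Definition optimal (A : optproblem) (I : raw_instance A) (x : solution I) :=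
  feasible x /\ forall y : solution I, feasible y -> cost x <= cost y.

Definition encodes_optimal (A : optproblem) (I : raw_instance A) (d : data) :=
  exists2 x : solution I, optimal x & d = enc_solution x.

(* Nothing is assumed about the answers to queries that do not encode an
   instance. *)
Definition solves (A : optproblem) (O : data -> data) : Prop :=
  forall I : raw_instance A, is_instance I ->
    encodes_optimal I (O (enc_instance I)).

Definition poly_reducible (A B : optproblem) : Prop :=
  exists (c : cmd) (a k : nat),
    forall O : data -> data, solves B O ->
    forall I : raw_instance A, is_instance I ->
    exists (t : nat) (d : data),
      [/\ computes O c (enc_instance I) t d,
          (t <= a * data_size (enc_instance I) ^ k + a)%N
        & encodes_optimal I d].

Definition equivalent (A B : optproblem) : Prop :=
  poly_reducible A B /\ poly_reducible B A.

(** * Encodings *)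

Fixpoint enc_list (l : seq data) : data :=
  if l is d :: l' then Pair d (enc_list l') else Nil.

Definition enc_fun (n : nat) (f : 'I_n -> data) : data :=
  enc_list [seq f i | i <- enum 'I_n].

(* A set of resources is the 0/1 list of its characteristic function. *)
Definition enc_set (s : nat) (A : {set 'I_s}) : data :=
  enc_fun (fun i => Num (i \in A)%:R).

(** * The scheduling problems *)

Record jobs := Jobs {
  njobs : nat;
  ptime : 'I_njobs -> rat;
  rdate : 'I_njobs -> rat;
  weight : 'I_njobs -> rat
}.

Definition release_dates (J : jobs) : seq rat :=
  undup [seq rdate j | j <- enum 'I_(njobs J)].

Definition valid_jobs (tau : nat) (J : jobs) : Prop :=
  (forall j : 'I_(njobs J), [/\ 0 < ptime j, 0 <= rdate j & 0 < weight j])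
  /\ (size (release_dates J) <= tau)%N.

Definition schedule (J : jobs) := 'I_(njobs J) -> rat.

Definition completion (J : jobs) (S : schedule J) (j : 'I_(njobs J)) : rat :=
  S j + ptime j.

Definition no_overlap (J : jobs) (S : schedule J) : Prop :=
  forall i j : 'I_(njobs J),
    i != j -> completion S i <= S j \/ completion S j <= S i.

Definition weighted_completion (J : jobs) (S : schedule J) : rat :=
  \sum_(j < njobs J) weight j * completion S j.

Definition enc_job (J : jobs) (j : 'I_(njobs J)) : seq data :=
  [:: Num (ptime j); Num (rdate j); Num (weight j)].

(* 1|r_j|sum w_j C_j, with at most [tau] distinct release dates.  The bound is
   needed here too: for [tau = 1] the joint replenishment problem is solvable in
   polynomial time, while the problem without the bound is strongly NP-hard. *)
Definition classical_problem (tau : nat) : optproblem := {|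
  raw_instance := jobs;
  is_instance := valid_jobs tau;
  solution := schedule;
  feasible := fun J S =>
    no_overlap S /\ forall j : 'I_(njobs J), rdate j <= S j;
  cost := fun J S => weighted_completion S;
  enc_instance := fun J => enc_fun (fun j : 'I_(njobs J) => enc_list (enc_job j));
  enc_solution := fun J S => enc_fun (fun j => Num (S j))
|}.

Record jrp_data (s : nat) := JrpData {
  jrp_jobs :> jobs;
  required : 'I_(njobs jrp_jobs) -> {set 'I_s};
  cost0 : rat;
  res_cost : 'I_s -> rat
}.

Definition valid_jrp (s tau : nat) (I : jrp_data s) : Prop :=
  [/\ valid_jobs tau I,
      forall j : 'I_(njobs I), required j != set0,
      0 <= cost0 I
    & forall i : 'I_s, 0 <= res_cost I i].

Definition replenishment (s : nat) := seq ({set 'I_s} * rat).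

Definition ready (s : nat) (I : jrp_data s) (Q : replenishment s)
    (j : 'I_(njobs I)) (t : rat) : bool :=
  required j \subset \bigcup_(x <- Q | rdate j <= x.2 <= t) x.1.

Definition replenishment_cost (s : nat) (I : jrp_data s)
    (Q : replenishment s) : rat :=
  \sum_(x <- Q) (cost0 I + \sum_(i in x.1) res_cost I i).

(* 1|jrp,r_j|sum w_j C_j + c_Q, with [s] resources and at most [tau] distinct
   release dates. *)
Definition jrp_problem (s tau : nat) : optproblem := {|
  raw_instance := jrp_data s;
  is_instance := valid_jrp tau;
  solution := fun I => (schedule I * replenishment s)%type;
  feasible := fun I x =>
    [/\ no_overlap x.1,
        sorted <%R [seq y.2 | y <- x.2]
      & forall j : 'I_(njobs I), ready x.2 j (x.1 j)];
  cost := fun I x => weighted_completion x.1 + replenishment_cost I x.2;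
  enc_instance := fun I =>
    Pair (enc_fun (fun j : 'I_(njobs I) =>
            enc_list (rcons (enc_job j) (enc_set (required j)))))
         (Pair (Num (cost0 I)) (enc_fun (fun i => Num (res_cost I i))));
  enc_solution := fun I x =>
    Pair (enc_fun (fun j => Num (x.1 j)))
         (enc_list [seq Pair (enc_set y.1) (Num y.2) | y <- x.2])
|}.

(* Main.v *)
From mathcomp Require Import all_boot all_order all_algebra.
From mathcomp Require Import zify lra.
Require Import Defs.
Set Implicit Arguments.
Unset Strict Implicit.
Unset Printing Implicit Defensive.
Import Order.TTheory GRing.Theory Num.Theory.
Local Open Scope ring_scope.

(** It is enough to replenish at release dates: moving every replenishment back
  to the latest release date before it, and merging those that meet, keeps all
  jobs ready and does not raise the cost.  With [s] resources and at most [tau]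
  dates only polynomially many replenishment structures are left.  Each of them
  makes job [j] available from the first of its dates at which all of [R(j)] has
  been replenished since [r_j]; these dates are again release dates, so they
  define an instance of the classical problem, and the best answer over all
  structures is optimal.  Conversely, a classical instance is a joint
  replenishment instance in which replenishing costs nothing.

  The answers of the oracle have polynomial length because in an optimal
  schedule every job starts at its release date or at the completion of another
  job, so every start time is a release date plus a sum of distinct processing
  times. *)

(** * Bit lengths *)

Lemma leq_bits m n : (m <= n)%N -> (bits m <= bits n)%N.
Proof. by move=> le_mn; rewrite ltnS leq_trunc_log. Qed.

Lemma ltn_exp2_bits m : (m < 2 ^ bits m)%N.
Proof. exact: trunc_log_ltn. Qed.

Lemma bits_leq m e : (0 < e)%N -> (m < 2 ^ e)%N -> (bits m <= e)%N.
Proof.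
move=> e_gt0 lt_m; rewrite /bits; have [->|m_gt0] := posnP m.
  by rewrite trunc_log0.
rewrite -(ltn_exp2l _ _ (isT : 1 < 2)%N).
exact: leq_ltn_trans (trunc_logP _ m_gt0) lt_m.
Qed.

Lemma bitsM m n : (bits (m * n) <= bits m + bits n)%N.
Proof.
by apply: bits_leq => //; rewrite expnD ltn_mul ?ltn_exp2_bits.
Qed.

Lemma bitsD m n : (bits (m + n) <= bits m + bits n)%N.
Proof.
apply: bits_leq => //; rewrite expnD.
have := ltn_exp2_bits m; have := ltn_exp2_bits n.
have : (1 < 2 ^ bits m)%N by rewrite -{1}(expn0 2) ltn_exp2l.
have : (1 < 2 ^ bits n)%N by rewrite -{1}(expn0 2) ltn_exp2l.
nia.
Qed.

Definition height (q : rat) : nat := (`|numq q| + `|denq q|)%N.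

Lemma height_frac (n d : int) :
  d != 0 -> (height (n%:~R / d%:~R) <= `|n| + `|d|)%N.
Proof.
move=> d_neq0; case: (divqP n d) => [/eqP|k x k_neq0].
  by rewrite (negPf d_neq0).
by rewrite /height !abszM leq_add // leq_pmull //; lia.
Qed.

Lemma heightD a b : (height (a + b) <= height a * height b)%N.
Proof.
have -> : a + b =
    (numq a * denq b + numq b * denq a)%:~R / (denq a * denq b)%:~R.
  rewrite -{1}[a]divq_num_den -{1}[b]divq_num_den.
  by rewrite addf_div ?intr_eq0 ?denq_neq0 // rmorphD !rmorphM.
apply: leq_trans (height_frac _ _) _; first by rewrite mulf_neq0 ?denq_neq0.
by rewrite /height; nia.
Qed.

Lemma heightM a b : (height (a * b) <= height a * height b)%N.
Proof.
have -> : a * b = (numq a * numq b)%:~R / (denq a * denq b)%:~R.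
  by rewrite -{1}[a]divq_num_den -{1}[b]divq_num_den mulf_div !rmorphM.
apply: leq_trans (height_frac _ _) _; first by rewrite mulf_neq0 ?denq_neq0.
by rewrite /height !abszM; nia.
Qed.

Lemma heightN a : height (- a) = height a.
Proof. by rewrite /height numqN denqN abszN. Qed.

Lemma heightV a : (height a^-1 <= height a)%N.
Proof.
have [->|a_neq0] := eqVneq a 0; first by rewrite invr0.
have -> : a^-1 = (denq a)%:~R / (numq a)%:~R.
  by rewrite -{1}[a]divq_num_den invf_div.
by apply: leq_trans (height_frac _ _) _; rewrite ?numq_eq0 // addnC.
Qed.

Definition rat_len (q : rat) : nat := bits (height q).

Lemma rat_lenD a b : (rat_len (a + b) <= rat_len a + rat_len b)%N.
Proof. exact: leq_trans (leq_bits (heightD a b)) (bitsM _ _). Qed.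

Lemma rat_lenM a b : (rat_len (a * b) <= rat_len a + rat_len b)%N.
Proof. exact: leq_trans (leq_bits (heightM a b)) (bitsM _ _). Qed.

Lemma rat_lenN a : rat_len (- a) = rat_len a.
Proof. by rewrite /rat_len heightN. Qed.

Lemma rat_lenV a : (rat_len a^-1 <= rat_len a)%N.
Proof. exact: leq_bits (heightV a). Qed.

Lemma rat_len_leq_size q : (rat_len q <= rat_size q)%N.
Proof. exact: bitsD. Qed.

Lemma rat_size_leq_len q : (rat_size q <= 2 * rat_len q)%N.
Proof.
have := @leq_bits `|numq q| (height q) (leq_addr _ _).
have := @leq_bits `|denq q| (height q) (leq_addl _ _).
by rewrite /rat_size /rat_len; lia.
Qed.

(* Unlike [data_size], this length is subadditive under arithmetic, so that
   accumulated sums and products stay short. *)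
Fixpoint data_len (d : data) : nat :=
  match d with
  | Nil => 1
  | Num q => (rat_len q).+1
  | Pair a b => (data_len a + data_len b).+1
  end.

Lemma data_len_gt0 d : (0 < data_len d)%N. Proof. by case: d. Qed.

Lemma data_len_leq_size d : (data_len d <= data_size d)%N.
Proof.
by elim: d => //= [q|a IHa b IHb]; rewrite ltnS ?rat_len_leq_size ?leq_add.
Qed.

Lemma data_size_leq_len d : (data_size d <= 2 * data_len d)%N.
Proof.
by elim: d => //= [q|a IHa b IHb]; [have := rat_size_leq_len q|]; lia.
Qed.

Lemma rat_len_to_rat d : (rat_len (to_rat d) <= data_len d)%N.
Proof. by case: d. Qed.

Lemma data_len_of_bool b : (data_len (of_bool b) <= 3)%N.
Proof. by case: b. Qed.

Lemma truth_of_bool b : truth (of_bool b) = b.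
Proof. by case: b. Qed.

Lemma data_len_binop o a b :
  (data_len (binop_eval o a b) <= (rat_len a + rat_len b).+1)%N.
Proof.
case: o => /=.
- by rewrite ltnS rat_lenD.
- by rewrite ltnS -(rat_lenN b) rat_lenD.
- by rewrite ltnS rat_lenM.
- by rewrite ltnS (leq_trans (rat_lenM _ _)) // leq_add2l rat_lenV.
- apply: leq_trans (data_len_of_bool _) _; rewrite ltnS.
  exact: (leq_add (isT : 0 < rat_len a) (isT : 0 < rat_len b))%N.
Qed.

Fixpoint items (d : data) : seq data :=
  if d is Pair a d' then a :: items d' else [::].

Lemma enc_listK : cancel enc_list items.
Proof. by elim=> //= a l ->. Qed.

Definition enc_seq (Y : Type) (eY : Y -> data) (l : seq Y) : data :=
  enc_list [seq eY y | y <- l].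

Lemma data_len_seq Y (eY : Y -> data) l :
  data_len (enc_seq eY l) = (\sum_(y <- l) (data_len (eY y)).+1).+1.
Proof.
elim: l => [|y l IH]; first by rewrite big_nil.
by rewrite big_cons /= -/(enc_seq eY l) IH; lia.
Qed.

Lemma size_leq_data_len Y (eY : Y -> data) l :
  (size l <= data_len (enc_seq eY l))%N.
Proof. by elim: l => //= y l; rewrite -/(enc_seq eY l); lia. Qed.

Lemma all_data_len Y (eY : Y -> data) l :
  all (fun y => data_len (eY y) <= data_len (enc_seq eY l))%N l.
Proof.
elim: l => //= y l IH; rewrite -/(enc_seq eY l); apply/andP; split; first lia.
by apply: sub_all IH => z; lia.
Qed.

Definition dfst (d : data) : data := if d is Pair a _ then a else Nil.
Definition dsnd (d : data) : data := if d is Pair _ b then b else Nil.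
Definition is_pair (d : data) : bool := if d is Pair _ _ then true else false.

Lemma data_len_dfst d : (data_len (dfst d) <= data_len d)%N.
Proof. by case: d => //= a b; lia. Qed.

Lemma data_len_dsnd d : (data_len (dsnd d) <= data_len d)%N.
Proof. by case: d => //= a b; lia. Qed.

(** * A functional language compiled to commands *)

(* Programs are point-free: each maps one value to one value, and environments
   are nested pairs.  [PFold f] takes [Pair l (Pair acc env)] and folds [f],
   which gets [Pair item (Pair acc env)], over the items of [l]. *)
Inductive prog :=
  | PId
  | PConst of data
  | PFst
  | PSnd
  | PIsPair
  | POp of binop
  | PPair of prog & prog
  | PComp of prog & prog
  | PIf of prog & prog & prog
  | PFold of prog
  | PAsk.

Definition pair_op (o : binop) (x : data) : data :=
  binop_eval o (to_rat (dfst x)) (to_rat (dsnd x)).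

Definition op_time (o : binop) (x : data) : nat :=
  (rat_size (to_rat (dfst x)) + rat_size (to_rat (dsnd x))
   + data_size (pair_op o x))%N.

Fixpoint fold_time (Y Z : Type) (step : Z -> Y -> Z) (time : Z -> Y -> nat)
    (z : Z) (l : seq Y) : nat :=
  if l is y :: l' then (time z y + fold_time step time (step z y) l')%N
  else 0%N.

Section Semantics.

Variable O : data -> data.

Fixpoint run (p : prog) (x : data) : data :=
  match p with
  | PId => x
  | PConst d => d
  | PFst => dfst x
  | PSnd => dsnd x
  | PIsPair => of_bool (is_pair x)
  | POp o => pair_op o x
  | PPair f g => Pair (run f x) (run g x)
  | PComp g f => run g (run f x)
  | PIf c f g => if truth (run c x) then run f x else run g x
  | PFold f =>
      foldl (fun acc it => run f (Pair it (Pair acc (dsnd (dsnd x)))))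
        (dfst (dsnd x)) (items (dfst x))
  | PAsk => O x
  end.

Fixpoint run_time (p : prog) (x : data) : nat :=
  match p with
  | PId => 1
  | PConst _ => 2
  | PFst | PSnd | PIsPair => 3
  | POp o => op_time o x + 6
  | PPair f g => run_time f x + run_time g x + 12
  | PComp g f => run_time f x + run_time g (run f x) + 1
  | PIf c f g =>
      run_time c x
      + (if truth (run c x) then run_time f x else run_time g x) + 6
  | PFold f =>
      fold_time (fun acc it => run f (Pair it (Pair acc (dsnd (dsnd x)))))
        (fun acc it => run_time f (Pair it (Pair acc (dsnd (dsnd x)))) + 19)
        (dfst (dsnd x)) (items (dfst x)) + 20
  | PAsk => data_size x + 2
  end%N.

End Semantics.

(* The list is in register [k.+1] and the pair of accumulator and environment in
   register [k]. *)
Definition fold_loop (k : nat) (body : cmd) : cmd :=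
  While (IsPair (Var k.+1))
    (Seq (Assign k.+2 (MkPair (Fst (Var k.+1)) (Var k)))
      (Seq (Assign k.+1 (Snd (Var k.+1)))
        (Seq body (Assign k (MkPair (Var k.+2) (Snd (Var k))))))).

(* [compile p k] replaces the content [x] of register [k] by [run O p x] and
   leaves the registers below [k] alone. *)
Fixpoint compile (p : prog) (k : nat) : cmd :=
  match p with
  | PId => Skip
  | PConst d => Assign k (Const d)
  | PFst => Assign k (Fst (Var k))
  | PSnd => Assign k (Snd (Var k))
  | PIsPair => Assign k (IsPair (Var k))
  | POp o => Assign k (Op o (Fst (Var k)) (Snd (Var k)))
  | PPair f g =>
      Seq (Assign k.+1 (Var k)) (Seq (compile f k.+1)
        (Seq (Assign k.+2 (Var k)) (Seq (compile g k.+2)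
          (Assign k (MkPair (Var k.+1) (Var k.+2))))))
  | PComp g f => Seq (compile f k) (compile g k)
  | PIf c f g =>
      Seq (Assign k.+1 (Var k)) (Seq (compile c k.+1)
        (If (Var k.+1) (compile f k) (compile g k)))
  | PFold f =>
      Seq (Assign k.+1 (Fst (Var k)))
        (Seq (Assign k (MkPair (Fst (Snd (Var k))) (Snd (Snd (Var k)))))
        (Seq (fold_loop k (compile f k.+2)) (Assign k (Fst (Var k)))))
  | PAsk => Query k (Var k)
  end.

Lemma upd_eq m x d : upd m x d x = d.
Proof. by rewrite /upd eqxx. Qed.

Lemma upd_neq m x d y : y != x -> upd m x d y = m y.
Proof. by rewrite /upd => /negPf ->. Qed.

Definition agree_below (k : nat) (m m' : store) : Prop :=
  forall j, (j < k)%N -> m' j = m j.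

Lemma agree_below_trans k l m1 m2 m3 :
  (k <= l)%N -> agree_below k m1 m2 -> agree_below l m2 m3 ->
  agree_below k m1 m3.
Proof.
by move=> le_kl m12 m23 j lt_jk; rewrite m23 ?m12 // (leq_trans lt_jk).
Qed.

Lemma agree_below_upd k x m d : (k <= x)%N -> agree_below k m (upd m x d).
Proof. by move=> le_kx j lt_jk; rewrite upd_neq //; lia. Qed.

Section CompileCorrect.

Variable O : data -> data.

Lemma exec_time_eq c m t t' m' : exec O c m t m' -> t = t' -> exec O c m t' m'.
Proof. by move=> h <-. Qed.

Definition transforms (c : cmd) (k : nat) (x y : data) (t : nat) : Prop :=
  forall m, m k = x ->
    exists m', [/\ exec O c m t m', m' k = y & agree_below k m m'].

Lemma transforms_assign e k x y t :
  (forall m, m k = x -> eval m e = y /\ (eval_time m e).+1 = t) ->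
  transforms (Assign k e) k x y t.
Proof.
move=> e_eval m /e_eval[<- <-]; exists (upd m k (eval m e)).
by split; [exact: ExecAssign | exact: upd_eq | exact: agree_below_upd].
Qed.

Lemma transforms_seq c c' k x y z t t' :
  transforms c k x y t -> transforms c' k y z t' ->
  transforms (Seq c c') k x z (t + t').+1.
Proof.
move=> c_ok c'_ok m /c_ok[m1 [exec1 /c'_ok[m2 [exec2 val2 below2]] below1]].
exists m2; split=> //; first exact: ExecSeq exec1 exec2.
exact: agree_below_trans below1 below2.
Qed.

(* [c] works on a copy in register [k.+1], so [x] is still available. *)
Lemma transforms_scratch c c' k x y z t t' :
  transforms c k.+1 x y t ->
  (forall m, m k = x -> m k.+1 = y ->
    exists m', [/\ exec O c' m t' m', m' k = z & agree_below k m m']) ->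
  transforms (Seq (Assign k.+1 (Var k)) (Seq c c')) k x z (t + t' + 4).
Proof.
move=> c_ok c'_ok m mk; pose m1 := upd m k.+1 (m k).
have [m2 [exec2 val2 below2]] := c_ok m1 (etrans (upd_eq _ _ _) mk).
have m2k : m2 k = x by rewrite below2 // /m1 upd_neq //; lia.
have [m3 [exec3 val3 below3]] := c'_ok m2 m2k val2.
exists m3; split=> //.
  have exec1 := ExecAssign O m k.+1 (Var k).
  by apply: exec_time_eq (ExecSeq exec1 (ExecSeq exec2 exec3)) _ => /=; lia.
apply: agree_below_trans (leqnn k) _ below3.
exact: agree_below_trans (leqnSn k) (agree_below_upd _ _ (leqnSn k)) below2.
Qed.

Definition loop_folds (f : prog) (c : cmd) (k : nat) (env l acc : data)
    (m : store) : Prop :=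
  let step acc it := run O f (Pair it (Pair acc env)) in
  let time acc it := (run_time O f (Pair it (Pair acc env)) + 19)%N in
  exists m', [/\ exec O (fold_loop k c) m
                   (fold_time step time acc (items l) + 3)%N m',
                 m' k = Pair (foldl step acc (items l)) env
               & agree_below k m m'].

Lemma loop_folds_end f c k env l acc m :
  ~~ is_pair l -> m k = Pair acc env -> m k.+1 = l ->
  loop_folds f c k env l acc m.
Proof.
move=> l_end mk ml; have l_nil : items l = [::] by case: l l_end {ml}.
exists m; rewrite l_nil; split=> //.
by apply: exec_time_eq (ExecWhileEnd _ _ _) _; rewrite //= ml truth_of_bool.
Qed.

Lemma exec_fold_loop f c k env l acc m :
  (forall x, transforms c k.+2 x (run O f x) (run_time O f x)) ->
  m k = Pair acc env -> m k.+1 = l -> loop_folds f c k env l acc m.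
Proof.
move=> c_ok; elim: l acc m => [|q|it _ l IHl] acc m mk ml.
1,2: exact: loop_folds_end.
pose m1 := upd m k.+2 (eval m (MkPair (Fst (Var k.+1)) (Var k))).
pose m2 := upd m1 k.+1 (eval m1 (Snd (Var k.+1))).
have m2x : m2 k.+2 = Pair it (Pair acc env).
  by rewrite /m2 upd_neq ?/m1 ?upd_eq /= ?ml ?mk //; lia.
have m2l : m2 k.+1 = l by rewrite /m2 upd_eq /= /m1 upd_neq ?ml //; lia.
have m2k : m2 k = Pair acc env by rewrite /m2 /m1 !upd_neq //; lia.
have [m3 [exec3 val3 below3]] := c_ok _ m2 m2x.
pose m4 := upd m3 k (eval m3 (MkPair (Var k.+2) (Snd (Var k)))).
have m4k : m4 k = Pair (run O f (Pair it (Pair acc env))) env.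
  by rewrite /m4 upd_eq /= val3 below3 ?m2k //; lia.
have m4l : m4 k.+1 = l by rewrite /m4 upd_neq ?below3 //; lia.
have [m5 [exec5 val5 below5]] := IHl _ m4 m4k m4l.
exists m5; split=> //.
- have exec1 := ExecAssign O m k.+2 (MkPair (Fst (Var k.+1)) (Var k)).
  have exec2 := ExecAssign O m1 k.+1 (Snd (Var k.+1)).
  have exec4 := ExecAssign O m3 k (MkPair (Var k.+2) (Snd (Var k))).
  have exec_body := ExecSeq exec1 (ExecSeq exec2 (ExecSeq exec3 exec4)).
  apply: exec_time_eq (ExecWhileStep _ exec_body exec5) _.
    by rewrite /= ml.
  by rewrite /=; lia.
- move=> j lt_jk; rewrite below5 // /m4 upd_neq ?below3 /m2 /m1 ?upd_neq //.
  all: by lia.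
Qed.

Lemma transforms_pair cf cg k x y z t u :
  transforms cf k.+1 x y t -> transforms cg k.+2 x z u ->
  transforms (Seq (Assign k.+1 (Var k)) (Seq cf (Seq (Assign k.+2 (Var k))
    (Seq cg (Assign k (MkPair (Var k.+1) (Var k.+2))))))) k x (Pair y z)
    (t + u + 12).
Proof.
move=> cf_ok cg_ok; have -> : (t + u + 12 = t + (u + 8) + 4)%N by lia.
apply: transforms_scratch cf_ok _ => m mk mk1.
pose m1 := upd m k.+2 (m k).
have m1x : m1 k.+2 = x by rewrite /m1 upd_eq.
have [m2 [exec2 val2 below2]] := cg_ok m1 m1x.
have m2k1 : m2 k.+1 = y by rewrite below2 // /m1 upd_neq //; lia.
exists (upd m2 k (eval m2 (MkPair (Var k.+1) (Var k.+2)))); split.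
- have exec1 := ExecAssign O m k.+2 (Var k).
  have exec3 := ExecAssign O m2 k (MkPair (Var k.+1) (Var k.+2)).
  by apply: exec_time_eq (ExecSeq exec1 (ExecSeq exec2 exec3)) _ => /=; lia.
- by rewrite upd_eq /= m2k1 val2.
- move=> j lt_jk; rewrite upd_neq ?below2 /m1 ?upd_neq //; lia.
Qed.

Lemma transforms_if c cf cg k x b y t u :
  transforms c k.+1 x b t ->
  transforms (if truth b then cf else cg) k x y u ->
  transforms (Seq (Assign k.+1 (Var k)) (Seq c (If (Var k.+1) cf cg))) k x y
    (t + u + 6).
Proof.
move=> c_ok branch_ok; have -> : (t + u + 6 = t + (u + 2) + 4)%N by lia.
apply: transforms_scratch c_ok _ => m /branch_ok[m' [exec' val' below']] mk1.
exists m'; split=> //.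
have exec_if : exec O (If (Var k.+1) cf cg) m (1 + u).+1 m'.
  by apply: ExecIf; rewrite /= mk1.
by apply: exec_time_eq exec_if _; lia.
Qed.

Lemma transforms_fold f k x :
  (forall y, transforms (compile f k.+2) k.+2 y (run O f y) (run_time O f y)) ->
  transforms (compile (PFold f) k) k x
    (run O (PFold f) x) (run_time O (PFold f) x).
Proof.
move=> f_ok m mk; pose rest := MkPair (Fst (Snd (Var k))) (Snd (Snd (Var k))).
pose m1 := upd m k.+1 (eval m (Fst (Var k))).
pose m2 := upd m1 k (eval m1 rest).
have m2k : m2 k = Pair (dfst (dsnd x)) (dsnd (dsnd x)).
  by rewrite /m2 upd_eq /= /m1 upd_neq ?mk //; lia.
have m2l : m2 k.+1 = dfst x.
  by rewrite /m2 upd_neq ?/m1 ?upd_eq /= ?mk //; lia.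
have [m3 [exec3 val3 below3]] := exec_fold_loop f_ok m2k m2l.
exists (upd m3 k (eval m3 (Fst (Var k)))); split.
- have exec1 := ExecAssign O m k.+1 (Fst (Var k)).
  have exec2 := ExecAssign O m1 k rest.
  have exec4 := ExecAssign O m3 k (Fst (Var k)).
  apply: exec_time_eq (ExecSeq exec1 (ExecSeq exec2 (ExecSeq exec3 exec4))) _.
  by rewrite /=; lia.
- by rewrite upd_eq /= val3.
- by move=> j lt_jk; rewrite upd_neq ?below3 /m2 /m1 ?upd_neq //; lia.
Qed.

Lemma compile_correct p k x :
  transforms (compile p k) k x (run O p x) (run_time O p x).
Proof.
elim: p k x
  => [|d||||o|f IHf g IHg|g IHg f IHf|c IHc f IHf g IHg|f IHf|] k x /=.
- by move=> m mk; exists m; split=> //; exact: ExecSkip.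
- exact: transforms_assign.
- by apply: transforms_assign => m /= ->.
- by apply: transforms_assign => m /= ->.
- by apply: transforms_assign => m /= ->.
- apply: transforms_assign => m /= ->; split=> //.
  by rewrite /op_time /pair_op -/(dfst x) -/(dsnd x); lia.
- exact: transforms_pair.
- by rewrite addn1; exact: transforms_seq (IHf k x) (IHg k _).
- by apply: transforms_if => //; case: ifP => _.
- by apply: transforms_fold => y; exact: IHf.
- move=> m mk; exists (upd m k (O (eval m (Var k)))); split.
  + by apply: exec_time_eq (ExecQuery _ _ _ _) _; rewrite /= mk; lia.
  + by rewrite upd_eq /= mk.
  + exact: agree_below_upd.
Qed.

Lemma compile_computes p x :
  computes O (compile p 0) x
    (run_time O p x + data_size (run O p x)) (run O p x).
Proof.
have [m [exec_p val_p _]] := compile_correct p (upd_eq (fun=> Nil) 0%N x).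
by exists (run_time O p x), m.
Qed.

End CompileCorrect.

(** * Polynomial time *)

Definition polybound (p : nat -> nat) : Prop :=
  {homo p : m n / (m <= n)%N} /\
  exists a k, forall n, (p n <= a * n.+1 ^ k)%N.

Lemma polybound_const c : polybound (fun=> c).
Proof. by split=> //; exists c, 0%N => n; rewrite muln1. Qed.

Lemma polybound_id : polybound id.
Proof. by split=> //; exists 1%N, 1%N => n; rewrite mul1n. Qed.

Lemma polyboundD p q :
  polybound p -> polybound q -> polybound (fun n => p n + q n)%N.
Proof.
move=> [mono_p [a [k le_p]]] [mono_q [b [l le_q]]]; split.
  by move=> m n le_mn; rewrite leq_add ?mono_p ?mono_q.
exists (a + b)%N, (k + l)%N => n; rewrite mulnDl leq_add //.
- by apply: leq_trans (le_p n) _; rewrite leq_mul2l leq_pexp2l ?leq_addr ?orbT.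
- by apply: leq_trans (le_q n) _; rewrite leq_mul2l leq_pexp2l ?leq_addl ?orbT.
Qed.

Lemma polyboundM p q :
  polybound p -> polybound q -> polybound (fun n => p n * q n)%N.
Proof.
move=> [mono_p [a [k le_p]]] [mono_q [b [l le_q]]]; split.
  by move=> m n le_mn; rewrite leq_mul ?mono_p ?mono_q.
exists (a * b)%N, (k + l)%N => n; rewrite expnD mulnACA.
by rewrite leq_mul.
Qed.

Lemma polybound_comp p q :
  polybound p -> polybound q -> polybound (fun n => p (q n)).
Proof.
move=> [mono_p [a [k le_p]]] [mono_q [b [l le_q]]]; split.
  by move=> m n le_mn; rewrite mono_p ?mono_q.
exists (a * b.+1 ^ k)%N, (l * k)%N => n.
apply: leq_trans (le_p _) _; rewrite -mulnA leq_mul2l expnM -expnMn.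
apply/orP; right.
have le_qn : ((q n).+1 <= b.+1 * n.+1 ^ l)%N.
  have := le_q n; have : (0 < n.+1 ^ l)%N by rewrite expn_gt0.
  by nia.
by case: (k) => // e; rewrite leq_exp2r.
Qed.

Ltac solve_polybound := repeat first
  [ assumption | exact: polybound_id | exact: polybound_const
  | apply: polyboundD | apply: polyboundM | apply: polybound_comp ].

Definition polytime (X : Type) (enc f : X -> data) : Prop :=
  exists p, exists2 q, polybound q & forall O x,
    run O p (enc x) = f x /\
    (run_time O p (enc x) + data_len (f x) <= q (data_len (enc x)))%N.

Definition polydec (X : Type) (enc : X -> data) (P : pred X) : Prop :=
  polytime enc (fun x => of_bool (P x)).

(* The context in which the body of a loop over lists of [Y x] is run. *)
Definition enc_item (X : Type) (enc : X -> data) (Y : X -> Type)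
    (eY : forall x, Y x -> data) (w : {x & Y x}) : data :=
  Pair (eY (tag w) (tagged w)) (enc (tag w)).

Section FoldBounds.

Variables (Y Z : Type) (step : Z -> Y -> Z) (good : pred Y).

Lemma foldl_size_leq (size_of : Z -> nat) a z l :
  (forall z y, good y -> size_of (step z y) <= size_of z + a)%N ->
  all good l -> (size_of (foldl step z l) <= size_of z + size l * a)%N.
Proof.
move=> growth; elim: l z => [|y l IH] z /=; first by rewrite addn0.
move=> /andP[good_y good_l]; apply: leq_trans (IH _ good_l) _.
by have := growth z y good_y; lia.
Qed.

Lemma fold_time_leq (size_of : Z -> nat) (time : Z -> Y -> nat) a b M z l :
  (forall z y, good y -> size_of (step z y) <= size_of z + a)%N ->
  (forall z y, good y -> size_of z <= M -> time z y <= b)%N ->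
  all good l -> (size_of z + size l * a <= M)%N ->
  (fold_time step time z l <= size l * b)%N.
Proof.
move=> growth time_b; elim: l z => //= y l IH z /andP[good_y good_l] le_M.
have le_Mz : (size_of z <= M)%N by lia.
rewrite mulSn leq_add ?time_b // IH //.
by have := growth z y good_y; lia.
Qed.

End FoldBounds.

Section EncodedFold.

Variables (O : data -> data) (p : prog) (env : data).
Variables (Y Z : Type) (eY : Y -> data) (eZ : Z -> data).
Variables (step : Z -> Y -> Z) (good : pred Y) (a b M : nat).

Hypothesis run_step : forall z y, good y ->
  run O p (Pair (eY y) (Pair (eZ z) env)) = eZ (step z y).
Hypothesis growth : forall z y, good y ->
  (data_len (eZ (step z y)) <= data_len (eZ z) + a)%N.
Hypothesis time_step : forall z y, good y -> (data_len (eZ z) <= M)%N ->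
  (run_time O p (Pair (eY y) (Pair (eZ z) env)) <= b)%N.

Let input l z := Pair (enc_seq eY l) (Pair (eZ z) env).

Lemma run_fold l z :
  all good l -> run O (PFold p) (input l z) = eZ (foldl step z l).
Proof.
rewrite /= enc_listK; elim: l z => //= y l IH z /andP[good_y good_l].
by rewrite run_step // IH.
Qed.

Lemma run_time_fold l z :
  all good l -> (data_len (eZ z) + size l * a <= M)%N ->
  (run_time O (PFold p) (input l z) <= size l * (b + 19) + 20)%N.
Proof.
move=> good_l le_M; pose time z y :=
  (run_time O p (Pair (eY y) (Pair (eZ z) env)) + 19)%N.
have time_le z' y : good y -> (data_len (eZ z') <= M)%N ->
    (time z' y <= b + 19)%N.
  by move=> good_y le_z'; rewrite leq_add2r time_step.
have le_time := fold_time_leq growth time_le good_l le_M.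
apply: leq_trans (leq_add le_time (leqnn 20)).
rewrite /= enc_listK leq_add2r.
elim: l z good_l {le_M le_time} => //= y l IH z /andP[good_y good_l].
by rewrite run_step // leq_add // IH.
Qed.

Lemma encoded_fold l z N :
  all good l -> (size l <= N)%N -> (data_len (eZ z) + N * a <= M)%N ->
  let folded := eZ (foldl step z l) in
  run O (PFold p) (input l z) = folded /\
  (run_time O (PFold p) (input l z) + data_len folded
   <= N * (b + 19) + 20 + M)%N.
Proof.
move=> good_l le_N le_M folded; split; first exact: run_fold.
have le_size c : (size l * c <= N * c)%N by rewrite leq_mul2r le_N orbT.
have le_Ml : (data_len (eZ z) + size l * a <= M)%N.
  by apply: leq_trans le_M; rewrite leq_add2l.
apply: leq_add.
  by apply: leq_trans (run_time_fold good_l le_Ml) _; rewrite leq_add2r.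
apply: leq_trans _ le_Ml.
exact: (foldl_size_leq (size_of := data_len \o eZ) z growth good_l).
Qed.

End EncodedFold.

Section Closure.

Variables (X : Type) (enc : X -> data).

Lemma eq_polytime (f g : X -> data) :
  f =1 g -> polytime enc f -> polytime enc g.
Proof.
by move=> eq_fg [p [q bound_q p_ok]]; exists p, q => // O x; rewrite -eq_fg.
Qed.

Lemma polytime_id : polytime enc enc.
Proof.
exists PId, (fun n => n + 1)%N; first by solve_polybound.
by move=> O x; split=> //=; lia.
Qed.

Lemma polytime_const d : polytime enc (fun=> d).
Proof.
by exists (PConst d), (fun=> 2 + data_len d)%N; first by solve_polybound.
Qed.

Lemma polytime_comp (X' : Type) (enc' : X' -> data) (h : X -> X') g :
  polytime enc (fun x => enc' (h x)) -> polytime enc' g ->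
  polytime enc (fun x => g (h x)).
Proof.
move=> [ph [qh bound_h h_ok]] [pg [qg bound_g g_ok]]; exists (PComp pg ph).
exists (fun n => qh n + qg (qh n) + 1)%N; first by solve_polybound.
move=> O x /=; have [-> le_h] := h_ok O x; have [-> le_g] := g_ok O (h x).
split=> //.
have : (qg (data_len (enc' (h x))) <= qg (qh (data_len (enc x))))%N.
  by apply: bound_g.1; lia.
by lia.
Qed.

Lemma polytime_trans enc' f :
  polytime enc enc' -> polytime enc' f -> polytime enc f.
Proof. exact: (polytime_comp (h := id)). Qed.

Lemma polytime_pair f g :
  polytime enc f -> polytime enc g -> polytime enc (fun x => Pair (f x) (g x)).
Proof.
move=> [pf [qf bound_f f_ok]] [pg [qg bound_g g_ok]]; exists (PPair pf pg).
exists (fun n => qf n + qg n + 13)%N; first by solve_polybound.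
move=> O x /=; have [-> le_f] := f_ok O x; have [-> le_g] := g_ok O x.
by split=> //; lia.
Qed.

Lemma polytime_fst f : polytime enc f -> polytime enc (fun x => dfst (f x)).
Proof.
move=> [p [q bound_q p_ok]]; exists (PComp PFst p), (fun n => q n + 4)%N.
  by solve_polybound.
move=> O x /=; have [-> le_q] := p_ok O x; split=> //.
by have := data_len_dfst (f x); lia.
Qed.

Lemma polytime_snd f : polytime enc f -> polytime enc (fun x => dsnd (f x)).
Proof.
move=> [p [q bound_q p_ok]]; exists (PComp PSnd p), (fun n => q n + 4)%N.
  by solve_polybound.
move=> O x /=; have [-> le_q] := p_ok O x; split=> //.
by have := data_len_dsnd (f x); lia.
Qed.

Lemma polydec_is_pair f :
  polytime enc f -> polydec enc (fun x => is_pair (f x)).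
Proof.
move=> [p [q bound_q p_ok]]; exists (PComp PIsPair p), (fun n => q n + 7)%N.
  by solve_polybound.
move=> O x /=; have [-> le_q] := p_ok O x; split=> //.
by have := data_len_of_bool (is_pair (f x)); lia.
Qed.

Lemma polytime_op o f g : polytime enc f -> polytime enc g ->
  polytime enc (fun x => binop_eval o (to_rat (f x)) (to_rat (g x))).
Proof.
move=> /polytime_pair pair_f /pair_f[p [q bound_q p_ok]].
exists (PComp (POp o) p), (fun n => 8 * q n + 10)%N; first by solve_polybound.
move=> O x /=; have [-> le_q] := p_ok O x; split=> //; move: le_q.
rewrite /op_time /pair_op /=; set d := binop_eval _ _ _.
have := data_len_binop o (to_rat (f x)) (to_rat (g x)); rewrite -/d.
have := data_size_leq_len d.
have := rat_size_leq_len (to_rat (f x)); have := rat_len_to_rat (f x).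
have := rat_size_leq_len (to_rat (g x)); have := rat_len_to_rat (g x).
by lia.
Qed.

Lemma polytime_if (P : pred X) f g :
  polydec enc P -> polytime enc f -> polytime enc g ->
  polytime enc (fun x => if P x then f x else g x).
Proof.
move=> [pP [qP bound_P P_ok]] [pf [qf bound_f f_ok]] [pg [qg bound_g g_ok]].
exists (PIf pP pf pg), (fun n => qP n + qf n + qg n + 6)%N.
  by solve_polybound.
move=> O x /=; have [-> leP] := P_ok O x; rewrite truth_of_bool.
have [ef le_f] := f_ok O x; have [eg le_g] := g_ok O x.
by case: ifP => _; split=> //; lia.
Qed.

Lemma polydec_not P : polydec enc P -> polydec enc (fun x => ~~ P x).
Proof.
move=> P_poly; apply: eq_polytime (polytime_if P_poly (polytime_const Nil)
  (polytime_const (Num 1))) => x.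
by case: (P x).
Qed.

Lemma polydec_and P Q :
  polydec enc P -> polydec enc Q -> polydec enc (fun x => P x && Q x).
Proof.
move=> P_poly Q_poly; apply: eq_polytime (polytime_if P_poly Q_poly
  (polytime_const Nil)) => x.
by case: (P x).
Qed.

Lemma polydec_or P Q :
  polydec enc P -> polydec enc Q -> polydec enc (fun x => P x || Q x).
Proof.
move=> P_poly Q_poly; apply: eq_polytime (polytime_if P_poly
  (polytime_const (Num 1)) Q_poly) => x.
by case: (P x).
Qed.

Lemma polydec_implies P Q :
  polydec enc P -> polydec enc Q -> polydec enc (fun x => P x ==> Q x).
Proof.
move=> P_poly Q_poly; apply: eq_polytime (polytime_if P_poly Q_poly
  (polytime_const (Num 1))) => x.
by case: (P x).
Qed.

Lemma polydec_forall (I : finType) (P : I -> pred X) :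
  (forall i, polydec enc (P i)) -> polydec enc (fun x => [forall i, P i x]).
Proof.
move=> P_poly; suff decP_all s : polydec enc (fun x => all (P^~ x) s).
  apply: eq_polytime (decP_all (enum I)) => x; congr of_bool.
  apply/allP/forallP => [P_all i|P_all i _]; last exact: P_all.
  by rewrite P_all ?mem_enum.
elim: s => [|i s IH]; first exact: polytime_const.
exact: polydec_and (P_poly i) IH.
Qed.

Lemma polytime_add (a b : X -> rat) :
  polytime enc (fun x => Num (a x)) -> polytime enc (fun x => Num (b x)) ->
  polytime enc (fun x => Num (a x + b x)).
Proof. by move=> a_poly b_poly; exact: (polytime_op Add a_poly b_poly). Qed.

Lemma polydec_le (a b : X -> rat) :
  polytime enc (fun x => Num (a x)) -> polytime enc (fun x => Num (b x)) ->
  polydec enc (fun x => a x <= b x).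
Proof. by move=> a_poly b_poly; exact: (polytime_op Le a_poly b_poly). Qed.

Lemma polydec_lt (a b : X -> rat) :
  polytime enc (fun x => Num (a x)) -> polytime enc (fun x => Num (b x)) ->
  polydec enc (fun x => a x < b x).
Proof.
move=> a_poly b_poly.
apply: eq_polytime (polydec_not (polydec_le b_poly a_poly)) => x.
by rewrite ltNge.
Qed.

Lemma polytime_nth n (l : X -> seq data) :
  polytime enc (fun x => enc_list (l x)) ->
  polytime enc (fun x => nth Nil (l x) n).
Proof.
elim: n l => [|n IH] l l_poly.
  by apply: eq_polytime (polytime_fst l_poly) => x; case: (l x).
have /IH : polytime enc (fun x => enc_list (behead (l x))).
  by apply: eq_polytime (polytime_snd l_poly) => x; case: (l x).
by apply: eq_polytime => x; rewrite nth_behead.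
Qed.

Lemma polydec_in_set s (A : X -> {set 'I_s}) i :
  polytime enc (fun x => enc_set (A x)) -> polydec enc (fun x => i \in A x).
Proof.
move=> /(polytime_nth i) /(polytime_op Le (polytime_const (Num 1))).
apply: eq_polytime => x /=.
by rewrite (nth_map i) ?size_enum_ord // nth_ord_enum; case: (i \in A x).
Qed.

Lemma polytime_head (Y : Type) (eY : Y -> data) (l : X -> seq Y) y0 :
  polytime enc (fun x => enc_seq eY (l x)) ->
  polytime enc (fun x => eY (y0 x)) ->
  polytime enc (fun x => eY (head (y0 x) (l x))).
Proof.
move=> l_poly y0_poly; apply: eq_polytime (polytime_if (polydec_is_pair l_poly)
  (polytime_fst l_poly) y0_poly) => x.
by case: (l x).
Qed.

End Closure.

Section LoopContexts.

Variables (X : Type) (enc : X -> data) (Y : X -> Type).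
Variable eY : forall x, Y x -> data.

Lemma polytime_tag f :
  polytime enc f -> polytime (enc_item enc eY) (fun w => f (tag w)).
Proof. by apply: polytime_comp; exact: polytime_snd (polytime_id _). Qed.

Lemma polytime_tagged :
  polytime (enc_item enc eY) (fun w => eY (tagged w)).
Proof. exact: polytime_fst (polytime_id _). Qed.

Lemma polytime_skip_acc (Z : Type) (eZ : Z -> data) f :
  polytime (enc_item enc eY) f ->
  polytime (enc_item (enc_item enc (fun _ : X => eZ)) (fun w => @eY (tag w)))
    (fun v => f (existT Y (tag (tag v)) (tagged v))).
Proof.
apply: polytime_comp; apply: polytime_pair (polytime_fst (polytime_id _)) _.
exact: polytime_snd (polytime_snd (polytime_id _)).
Qed.

End LoopContexts.

(* Accumulators may only grow additively: this is what keeps a loop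
   polynomial. *)
Lemma polytime_foldl (X : Type) (enc : X -> data) (Y : X -> Type)
    (eY : forall x, Y x -> data) (l : forall x, seq (Y x))
    (Z : Type) (eZ : Z -> data) (z0 : X -> Z) (step : forall x, Z -> Y x -> Z) :
  polytime enc (fun x => enc_seq (eY x) (l x)) ->
  polytime enc (fun x => eZ (z0 x)) ->
  polytime (enc_item (enc_item enc (fun _ => eZ)) (fun w => eY (tag w)))
    (fun v => eZ (step (tag (tag v)) (tagged (tag v)) (tagged v))) ->
  (exists2 g, polybound g & forall x z y,
     (data_len (eZ (step x z y))
      <= data_len (eZ z) + g (data_len (eY x y) + data_len (enc x)))%N) ->
  polytime enc (fun x => eZ (foldl (step x) (z0 x) (l x))).
Proof.
move=> l_poly z0_poly [p [q bound_q p_ok]] [g bound_g step_le].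
pose input x := Pair (enc_seq (eY x) (l x)) (Pair (eZ (z0 x)) (enc x)).
apply: (polytime_trans (enc' := input)).
  exact: polytime_pair l_poly (polytime_pair z0_poly (polytime_id enc)).
pose M n := (n + n * g n)%N; exists (PFold p).
exists (fun n => n * (q (n + M n) + 19) + 20 + M n)%N.
  by rewrite /M; solve_polybound.
move=> O x; set n := data_len (input x).
have len_input : n = (data_len (enc_seq (eY x) (l x)) + data_len (eZ (z0 x))
  + data_len (enc x) + 2)%N by rewrite /n /=; lia.
pose good y := (data_len (eY x y) + data_len (enc x) + 2 <= n)%N.
apply: (encoded_fold (good := good) (a := g n)).
- by move=> z y _; have [-> _] := p_ok O (existT _ (existT _ x z) y).
- move=> z y good_y; apply: leq_trans (step_le _ _ _) _; rewrite leq_add2l.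
  by apply: bound_g.1; move: good_y; rewrite /good; lia.
- move=> z y good_y le_M; have [_ le_q] := p_ok O (existT _ (existT _ x z) y).
  apply: leq_trans (leq_trans (leq_addr _ _) le_q) _; apply: bound_q.1 => /=.
  by move: good_y; rewrite /good; lia.
- by apply: sub_all (all_data_len (eY x) (l x)) => y; rewrite /good; lia.
- by have := size_leq_data_len (eY x) (l x); lia.
- by rewrite leq_add2r; lia.
Qed.

Lemma foldl_cons_catrev T (s1 s2 : seq T) :
  foldl (fun acc x => x :: acc) s2 s1 = catrev s1 s2.
Proof. by elim: s1 s2 => //= x s1 IH s2; exact: IH. Qed.

Lemma foldl_catrev T1 T2 (f : T1 -> seq T2) s acc :
  foldl (fun acc x => catrev (f x) acc) acc s =
  catrev (flatten [seq f x | x <- s]) acc.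
Proof. by elim: s acc => //= x s IH acc; rewrite IH !catrevE rev_cat catA. Qed.

Lemma data_len_catrev s1 s2 :
  (data_len (enc_list (catrev s1 s2))
   <= data_len (enc_list s2) + data_len (enc_list s1))%N.
Proof.
elim: s1 s2 => [|d s1 IH] s2 /=; first by lia.
by have := IH (d :: s2) => /=; lia.
Qed.

Lemma polytime_catrev (X : Type) (enc : X -> data) (s1 s2 : X -> seq data) :
  polytime enc (fun x => enc_list (s1 x)) ->
  polytime enc (fun x => enc_list (s2 x)) ->
  polytime enc (fun x => enc_list (catrev (s1 x) (s2 x))).
Proof.
move=> s1_poly s2_poly.
have items_poly : polytime enc (fun x => enc_seq id (s1 x)).
  by apply: eq_polytime s1_poly => x; rewrite /enc_seq map_id.
apply: eq_polytime (polytime_foldl items_poly (eZ := enc_list) (z0 := s2)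
  (step := fun _ acc d => d :: acc) s2_poly _ _) => [x||].
- by rewrite foldl_cons_catrev.
- exact: polytime_pair (polytime_tagged _ _)
    (polytime_tag _ (polytime_tagged _ _)).
- by exists (fun n => n + 1)%N; [solve_polybound | move=> x z y /=; lia].
Qed.

Section ListLoops.

Variables (X : Type) (enc : X -> data) (Y : X -> Type).
Variables (eY : forall x, Y x -> data) (l : forall x, seq (Y x)).

Hypothesis l_poly : polytime enc (fun x => enc_seq (@eY x) (l x)).

Lemma polytime_flatmap (Z : X -> Type) (eZ : forall x, Z x -> data)
    (g : forall x, Y x -> seq (Z x)) :
  polytime (enc_item enc eY)
    (fun w => enc_seq (@eZ (tag w)) (g (tag w) (tagged w))) ->
  polytime enc (fun x => enc_seq (@eZ x) (flatten [seq g x y | y <- l x])).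
Proof.
move=> g_poly; pose h x y := [seq eZ x z | z <- g x y].
pose rev_map x := foldl (fun acc y => catrev (h x y) acc) [::] (l x).
have rev_poly : polytime enc (fun x => enc_list (rev_map x)).
  apply: (polytime_foldl l_poly (eZ := enc_list) (z0 := fun=> [::])
    (step := fun x acc y => catrev (h x y) acc)).
  - exact: polytime_const.
  - exact: polytime_catrev (polytime_skip_acc _ g_poly)
      (polytime_tag _ (polytime_tagged _ _)).
  - case: g_poly => p [q bound_q p_ok]; exists (fun n => q (n + 1))%N.
      by solve_polybound.
    move=> x z y; apply: leq_trans (data_len_catrev _ _) _; rewrite leq_add2l.
    have [_] := p_ok id (existT _ x y); rewrite /= -addn1.
    by apply: leq_trans; exact: leq_addl.
have nil_poly : polytime enc (fun=> enc_list [::]) by exact: polytime_const.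
apply: eq_polytime (polytime_catrev rev_poly nil_poly) => x.
rewrite /rev_map foldl_catrev !catrevE !cats0 revK.
by rewrite /enc_seq map_flatten -map_comp.
Qed.

Lemma polytime_map (Z : X -> Type) (eZ : forall x, Z x -> data)
    (g : forall x, Y x -> Z x) :
  polytime (enc_item enc eY) (fun w => eZ (tag w) (g (tag w) (tagged w))) ->
  polytime enc (fun x => enc_seq (@eZ x) [seq g x y | y <- l x]).
Proof.
move=> g_poly; apply: eq_polytime
  (polytime_flatmap (eZ := eZ) (g := fun x y => [:: g x y]) _) => [x|].
- by rewrite flatten_map1.
- exact: polytime_pair g_poly (polytime_const _ Nil).
Qed.

Lemma polytime_filter (P : forall x, pred (Y x)) :
  polydec (enc_item enc eY) (fun w => P (tag w) (tagged w)) ->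
  polytime enc (fun x => enc_seq (@eY x) [seq y <- l x | P x y]).
Proof.
move=> P_poly; pose g x y := if P x y then [:: y] else [::].
apply: eq_polytime (polytime_flatmap (eZ := eY) (g := g) _) => [x|].
- congr enc_seq; rewrite /g; elim: (l x) => //= y s <-.
  by case: ifP.
- apply: eq_polytime (polytime_if P_poly (polytime_pair (polytime_tagged _ _)
    (polytime_const _ Nil)) (polytime_const _ Nil)) => w.
  by rewrite /g; case: ifP.
Qed.

Lemma polydec_has (P : forall x, pred (Y x)) :
  polydec (enc_item enc eY) (fun w => P (tag w) (tagged w)) ->
  polydec enc (fun x => has (P x) (l x)).
Proof.
move=> P_poly; apply: eq_polytime (polytime_foldl l_poly (eZ := of_bool)
  (z0 := fun=> false) (step := fun x b y => b || P x y) _ _ _) => [x|||].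
- suff fold_has b s :
      foldl (fun b y => b || P x y) b s = b || has (P x) s by rewrite fold_has.
  by elim: s b => [|y s IH] b /=; rewrite ?orbF // IH orbA.
- exact: polytime_const.
- exact: polydec_or (polytime_tag _ (polytime_tagged _ _))
    (polytime_skip_acc _ P_poly).
- exists (fun=> 3)%N; first by solve_polybound.
  by move=> x b y; apply: leq_trans (data_len_of_bool _) (leq_addl _ _).
Qed.

Lemma polydec_all (P : forall x, pred (Y x)) :
  polydec (enc_item enc eY) (fun w => P (tag w) (tagged w)) ->
  polydec enc (fun x => all (P x) (l x)).
Proof.
move=> /polydec_not/(polydec_has (P := fun x y => ~~ P x y))/polydec_not.
apply: eq_polytime => x; rewrite -all_predC; congr of_bool.
by apply: eq_all => y /=; rewrite negbK.
Qed.

Lemma polytime_sum (F : forall x, Y x -> rat) :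
  polytime (enc_item enc eY) (fun w => Num (F (tag w) (tagged w))) ->
  polytime enc (fun x => Num (\sum_(y <- l x) F x y)).
Proof.
move=> F_poly; apply: eq_polytime (polytime_foldl l_poly (eZ := Num)
  (z0 := fun=> 0) (step := fun x s y => s + F x y) _ _ _) => [x|||].
- suff fold_sum r s :
      foldl (fun r y => r + F x y) r s = r + \sum_(y <- s) F x y.
    by rewrite fold_sum add0r.
  by elim: s r => [|y s IH] r /=; rewrite ?big_nil ?addr0 // IH big_cons addrA.
- exact: polytime_const.
- exact: polytime_add (polytime_tag _ (polytime_tagged _ _))
    (polytime_skip_acc _ F_poly).
- case: F_poly => p [q bound_q p_ok]; exists (fun n => q (n + 1))%N.
    by solve_polybound.
  move=> x s y /=; have [_] := p_ok id (existT _ x y).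
  by rewrite /= addn1; have := rat_lenD s (F x y); lia.
Qed.

End ListLoops.

Definition argmin_seq (Y : Type) (F : Y -> rat) (y0 : Y) (l : seq Y) : Y :=
  foldl (fun best y => if F best <= F y then best else y) y0 l.

Lemma argmin_seqP (Y : eqType) (F : Y -> rat) y0 l :
  argmin_seq F y0 l \in y0 :: l /\
  forall y, y \in y0 :: l -> F (argmin_seq F y0 l) <= F y.
Proof.
rewrite /argmin_seq; elim: l y0 => [|z l IH] y0 /=.
  by split=> [|y]; rewrite inE // => /eqP->.
set y1 := if _ then _ else _; have [mem_min min_le] := IH y1.
have [y1_y0 y1_z] : F y1 <= F y0 /\ F y1 <= F z.
  by rewrite /y1; case: (leP (F y0) (F z)) => [|/ltW]; split.
split=> [|y].
- move: mem_min; rewrite !inE => /orP[/eqP->|->]; last by rewrite !orbT.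
  by rewrite /y1; case: ifP; rewrite eqxx ?orbT.
- have min_y1 := min_le y1 (mem_head _ _).
  rewrite !inE => /or3P[/eqP->|/eqP->|y_l]; first exact: le_trans y1_y0.
    exact: le_trans y1_z.
  by apply: min_le; rewrite inE y_l orbT.
Qed.

Lemma polytime_argmin (X Y : Type) (enc : X -> data) (eY : Y -> data)
    (F : X -> Y -> rat) (y0 : X -> Y) (l : X -> seq Y) :
  polytime enc (fun x => enc_seq eY (l x)) ->
  polytime enc (fun x => eY (y0 x)) ->
  polytime (enc_item enc (fun=> eY)) (fun w => Num (F (tag w) (tagged w))) ->
  polytime enc (fun x => eY (argmin_seq (F x) (y0 x) (l x))).
Proof.
move=> l_poly y0_poly F_poly; apply: (polytime_foldl l_poly (eZ := eY)
  (step := fun x best y => if F x best <= F x y then best else y)) => //.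
- have acc_poly := polytime_tagged (enc_item enc (fun=> eY)) (fun=> eY).
  have best_le :=
    polydec_le (polytime_tag (fun=> eY) F_poly) (polytime_skip_acc eY F_poly).
  apply: eq_polytime (polytime_if best_le
    (polytime_tag _ (polytime_tagged _ _)) (polytime_tagged _ _)) => v.
  by case: ifP.
- by exists id; [solve_polybound | move=> x z y; case: ifP => _; lia].
Qed.

Definition enc_pair (X1 X2 : Type) (e1 : X1 -> data) (e2 : X2 -> data)
    (z : X1 * X2) : data := Pair (e1 z.1) (e2 z.2).

Section Pairs.

Variables (X1 X2 : Type) (e1 : X1 -> data) (e2 : X2 -> data).

Lemma polytime_on_fst f :
  polytime e1 f -> polytime (enc_pair e1 e2) (fun z => f z.1).
Proof. by apply: polytime_comp; exact: polytime_fst (polytime_id _). Qed.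

Lemma polytime_on_snd f :
  polytime e2 f -> polytime (enc_pair e1 e2) (fun z => f z.2).
Proof. by apply: polytime_comp; exact: polytime_snd (polytime_id _). Qed.

Lemma polydec_rel (X : Type) (enc : X -> data) (r : X1 -> X2 -> bool) f1 f2 :
  polydec (enc_pair e1 e2) (fun z => r z.1 z.2) ->
  polytime enc (fun x => e1 (f1 x)) -> polytime enc (fun x => e2 (f2 x)) ->
  polydec enc (fun x => r (f1 x) (f2 x)).
Proof.
move=> r_poly f1_poly f2_poly.
exact: (polytime_comp (h := fun x => (f1 x, f2 x))
  (polytime_pair f1_poly f2_poly) r_poly).
Qed.

End Pairs.

Definition dot (xs ys : seq rat) : rat := \sum_(z <- zip xs ys) z.1 * z.2.

Lemma polytime_dot (X : Type) (enc : X -> data) (xs ys : X -> seq rat) :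
  polytime enc (fun x => enc_seq Num (xs x)) ->
  polytime enc (fun x => enc_seq Num (ys x)) ->
  polytime enc (fun x => Num (dot (xs x) (ys x))).
Proof.
move=> xs_poly ys_poly; pose state := (seq rat * rat)%type.
pose e_state : state -> data := enc_pair (enc_seq Num) Num.
pose step (st : state) a := (behead st.1, st.2 + a * head 0 st.1).
suff dot_poly : polytime enc (fun x => e_state (foldl step (ys x, 0) (xs x))).
  apply: eq_polytime (polytime_snd dot_poly) => x /=; congr Num.
  suff fold_dot u v r : (foldl step (v, r) u).2 = r + dot u v.
    by rewrite fold_dot add0r.
  rewrite /dot; elim: u v r => [|a u IH] [|b v] r.
  - by rewrite big_nil addr0.
  - by rewrite big_nil addr0.
  - by rewrite /= IH /= mulr0 addr0; case: (u).
  - by rewrite /= IH big_cons addrA.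
apply: (polytime_foldl xs_poly (eZ := e_state) (step := fun _ => step)).
- exact: polytime_pair ys_poly (polytime_const _ (Num 0)).
- have st_poly := polytime_tag (fun _ : {_ : X & state} => Num)
    (polytime_tagged enc (fun=> e_state)).
  have rest_poly := polytime_fst st_poly.
  have head_poly :=
    polytime_op Mul (polytime_tagged _ _) (polytime_fst rest_poly).
  have sum_poly := polytime_op Add (polytime_snd st_poly) head_poly.
  apply: eq_polytime (polytime_pair (polytime_snd rest_poly) sum_poly).
  by move=> [[x [[|b v] r]] a].
- exists (fun n => n + 1)%N; first by solve_polybound.
  move=> x [[|b v] r] a /=; rewrite /e_state /=.
    by rewrite mulr0 addr0; lia.
  rewrite -/(enc_seq Num v).
  by have := rat_lenD r (a * b); have := rat_lenM a b; lia.
Qed.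

Fixpoint chains (Y : Type) (r : rel Y) (n : nat) (G : seq Y) : seq (seq Y) :=
  if n is n'.+1 then
    [::] :: [seq y :: c | y <- G, c <- [seq c <- chains r n' G | all (r y) c]]
  else [:: [::]].

Lemma mem_chains (Y : eqType) (r : rel Y) n G c :
  transitive r ->
  (c \in chains r n G) = [&& (size c <= n)%N, all [in G] c & sorted r c].
Proof.
move=> r_tr; elim: n c => [|n IH] c /=.
  by rewrite inE -size_eq0 leqn0; case: c => // y c; rewrite andbF.
rewrite inE; case: c => [|y c] //=; rewrite (path_sortedE r_tr).
apply/allpairsPdep/idP => [[z [d [zG]]]|].
  rewrite mem_filter IH => /and4P[zd sd dG rd] [-> ->].
  by rewrite ltnS sd zG dG zd rd.
case/and3P => sc /andP[yG cG] /andP[yc rc]; exists y, c.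
by rewrite mem_filter IH yG yc cG rc -ltnS sc.
Qed.

Lemma polytime_chains (X Y : Type) (enc : X -> data) (eY : Y -> data)
    (r : rel Y) n (G : X -> seq Y) :
  polydec (enc_pair eY eY) (fun z => r z.1 z.2) ->
  polytime enc (fun x => enc_seq eY (G x)) ->
  polytime enc (fun x => enc_seq (enc_seq eY) (chains r n (G x))).
Proof.
move=> r_dec G_poly; elim: n => [|n IH] /=; first exact: polytime_const.
apply: polytime_pair (polytime_const _ _) _.
apply: (polytime_flatmap G_poly (eZ := fun=> enc_seq eY)).
have chains_poly := polytime_tag (fun=> eY) IH.
pose link_poly :=
  polytime_filter chains_poly (P := fun w => all (r (tagged w))).
apply: (polytime_map (eZ := fun=> enc_seq eY) (link_poly _)).
- apply: (polydec_all (eY := fun=> eY) (polytime_tagged _ _)).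
  have y_poly := polytime_tag (fun=> eY)
    (polytime_tag (fun=> enc_seq eY) (polytime_tagged enc (fun=> eY))).
  exact: polydec_rel r_dec y_poly (polytime_tagged _ _).
- exact: polytime_pair (polytime_tag _ (polytime_tagged _ _))
    (polytime_tagged _ _).
Qed.

(** * Reductions *)

Lemma run_comp O g f x : run O (PComp g f) x = run O g (run O f x).
Proof. by []. Qed.

Lemma run_time_comp O g f x :
  run_time O (PComp g f) x = (run_time O f x + run_time O g (run O f x) + 1)%N.
Proof. by []. Qed.

Lemma poly_reducible_run (A B : optproblem) (p : prog) (q : nat -> nat) :
  polybound q ->
  (forall O (I : raw_instance A), solves B O -> is_instance I ->
     (run_time O p (enc_instance I) + data_len (run O p (enc_instance I))
      <= q (data_len (enc_instance I)))%N /\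
     encodes_optimal I (run O p (enc_instance I))) ->
  poly_reducible A B.
Proof.
move=> [mono_q [a [k le_q]]] p_ok.
exists (compile p 0), (2 * a * 2 ^ k)%N, k => O solO I instI.
have [] := p_ok O I solO instI; set d := enc_instance I => le_time optI.
exists (run_time O p d + data_size (run O p d))%N, (run O p d).
split=> //; first exact: compile_computes.
have size_gt0 : (0 < data_size d)%N.
  by have := data_len_leq_size d; have := data_len_gt0 d; lia.
have le_pow : ((data_size d).+1 ^ k <= 2 ^ k * data_size d ^ k)%N.
  by rewrite -expnMn; case: (k) => // e; rewrite leq_exp2r //; lia.
have le_poly : (q (data_len d) <= a * (2 ^ k * data_size d ^ k))%N.
  apply: leq_trans (mono_q _ _ (data_len_leq_size d)) _.
  by apply: leq_trans (le_q _) _; rewrite leq_mul2l le_pow orbT.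
by have := data_size_leq_len (run O p d); nia.
Qed.

Definition short_optima (B : optproblem) : Prop :=
  exists2 q, polybound q & forall (J : raw_instance B) (x : solution J),
    is_instance J -> optimal x ->
    (data_len (enc_solution x) <= q (data_len (enc_instance J)))%N.

Section NonadaptiveReduction.

Variables (A B : optproblem) (C Y : eqType) (eC : C -> data) (eY : Y -> data).
(* Solutions of different instances have different types; their codes fit into
   one list of answers. *)
Variable code : forall J : raw_instance B, solution J -> Y.
Variables (cands : raw_instance A -> seq C).
Variable query : raw_instance A -> C -> raw_instance B.
Variable combine : raw_instance A -> seq (Y * C) -> data.

Hypothesis enc_solution_code :
  forall (J : raw_instance B) (x : solution J), enc_solution x = eY (code x).
Hypothesis B_short : short_optima B.

Hypothesis cands_poly :
  polytime (@enc_instance A) (fun I => enc_seq eC (cands I)).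
Hypothesis query_poly :
  polytime (enc_pair (@enc_instance A) eC)
    (fun z => enc_instance (query z.1 z.2)).
Hypothesis combine_poly :
  polytime (enc_pair (@enc_instance A) (enc_seq (enc_pair eY eC)))
    (fun z => combine z.1 z.2).

Hypothesis query_instance : forall I c,
  is_instance I -> c \in cands I -> is_instance (query I c).

Definition optimal_answers (I : raw_instance A) (zs : seq (Y * C)) : Prop :=
  [seq z.2 | z <- zs] =i cands I /\
  forall y c, (y, c) \in zs ->
    exists2 x : solution (query I c), optimal x & code x = y.

Hypothesis combine_optimal : forall I zs,
  is_instance I -> optimal_answers I zs -> encodes_optimal I (combine I zs).

Section Answers.

Variables (O : data -> data) (I : raw_instance A).
Hypotheses (solO : solves B O) (instI : is_instance I).

Definition ask_step (acc : seq data) (c : C) : seq data :=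
  Pair (O (enc_instance (query I c))) (eC c) :: acc.

Lemma optimal_answersP : exists2 zs, optimal_answers I zs &
  foldl ask_step [::] (cands I) = [seq enc_pair eY eC z | z <- zs].
Proof.
suff [zs [dom_zs opt_zs] ->] : exists2 zs,
    [seq z.2 | z <- zs] = rev (cands I) /\
    (forall y c, (y, c) \in zs ->
      exists2 x : solution (query I c), optimal x & code x = y)
    & foldl ask_step [::] (cands I) = [seq enc_pair eY eC z | z <- zs].
  by exists zs => //; split=> // c; rewrite dom_zs mem_rev.
have: {subset cands I <= cands I} by [].
elim/last_ind: {1 3 4}(cands I) => [|s c IH] sub_s; first by exists [::].
have [|zs [dom_zs opt_zs] fold_s] := IH.
  by move=> c' c's; apply: sub_s; rewrite mem_rcons inE c's orbT.
have cand_c : c \in cands I by apply: sub_s; rewrite mem_rcons mem_head.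
have [x opt_x ans_x] := solO (query_instance instI cand_c).
exists ((code x, c) :: zs); last first.
  by rewrite foldl_rcons fold_s /ask_step ans_x enc_solution_code.
split=> [|y c']; first by rewrite rev_rcons /= dom_zs.
rewrite inE => /predU1P[[-> ->]|]; last exact: opt_zs.
by exists x.
Qed.

End Answers.

Lemma ask_step_program : exists p, exists2 b, polybound b &
  forall O I acc c, solves B O -> is_instance I -> c \in cands I ->
    let x := Pair (eC c) (Pair (enc_list acc) (enc_instance I)) in
    let acc' := enc_list (ask_step O I acc c) in
    [/\ run O p x = acc',
        (run_time O p x <= b (data_len (enc_instance I)))%N
      & (data_len acc'
         <= data_len (enc_list acc) + b (data_len (enc_instance I)))%N].
Proof.
have [q_short bound_short short] := B_short.
have [p_cands [q_cands bound_cands cands_ok]] := cands_poly.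
have [p_query [q_query bound_query query_ok]] := query_poly.
pose p_ask := PComp PAsk (PComp p_query (PPair (PComp PSnd PSnd) PFst)).
exists (PPair (PPair p_ask PFst) (PComp PFst PSnd)).
pose query_len n := q_query (n + q_cands n + 1)%N.
exists (fun n => 3 * query_len n + q_short (query_len n) + q_cands n + 60)%N.
  by rewrite /query_len; solve_polybound.
move=> O I acc c solO instI cand_c; set n := data_len (enc_instance I).
have len_c : (data_len (eC c) <= q_cands n)%N.
  apply: leq_trans (allP (all_data_len eC (cands I)) c cand_c) _.
  by have [_] := cands_ok O I; apply: leq_trans; exact: leq_addl.
have [run_c le_query] := query_ok O (I, c).
rewrite /enc_pair /= in run_c le_query.
have {}le_query : (run_time O p_query (Pair (enc_instance I) (eC c))
    + data_len (enc_instance (query I c)) <= query_len n)%N.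
  by apply: leq_trans le_query _; apply: bound_query.1; rewrite -/n; lia.
have [x opt_x ans_x] := solO _ (query_instance instI cand_c).
have le_ans :
    (data_len (O (enc_instance (query I c))) <= q_short (query_len n))%N.
  rewrite ans_x.
  apply: leq_trans (short _ _ (query_instance instI cand_c) opt_x) _.
  by apply: bound_short.1; lia.
have := data_size_leq_len (enc_instance (query I c)).
by rewrite /= run_c; split=> //; lia.
Qed.

Lemma collect_answers_program : exists p, exists2 q, polybound q &
  forall O I, solves B O -> is_instance I ->
    let answers := enc_list (foldl (ask_step O I) [::] (cands I)) in
    run O p (enc_instance I) = answers /\
    (run_time O p (enc_instance I) + data_len answers
     <= q (data_len (enc_instance I)))%N.
Proof.
have [p_step [b bound_b step_ok]] := ask_step_program.
have [p_cands [q_cands bound_cands cands_ok]] := cands_poly.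
pose p_input := PPair p_cands (PPair (PConst Nil) PId).
exists (PComp (PFold p_step) p_input).
pose M n := (1 + q_cands n * b n)%N.
exists (fun n => q_cands n + q_cands n * (b n + 19) + 48 + M n)%N.
  by rewrite /M; solve_polybound.
move=> O I solO instI answers; set n := data_len (enc_instance I).
have [run_cands le_cands] := cands_ok O I; rewrite -/n in le_cands.
have run_input : run O p_input (enc_instance I) =
    Pair (enc_seq eC (cands I)) (Pair (enc_list [::]) (enc_instance I)).
  by rewrite /= run_cands.
have time_input : (run_time O p_input (enc_instance I) =
    run_time O p_cands (enc_instance I) + 27)%N by rewrite /=; lia.
rewrite run_comp run_time_comp run_input time_input.
have [||||||-> le_fold] := @encoded_fold O p_step (enc_instance I) _ _ eC
  enc_list (ask_step O I) [in cands I] (b n) (b n) (M n) _ _ _ (cands I) [::]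
  (q_cands n).
- by move=> acc c /(step_ok _ _ acc c solO instI)[].
- by move=> acc c /(step_ok _ _ acc c solO instI)[].
- by move=> acc c /(step_ok _ _ acc c solO instI)[].
- exact/allP.
- by have := size_leq_data_len eC (cands I); lia.
- by [].
by split=> //; rewrite /answers; lia.
Qed.

Theorem nonadaptive_reduction : poly_reducible A B.
Proof.
have [p [q bound_q p_ok]] := collect_answers_program.
have [p_combine [q_combine bound_combine combine_ok]] := combine_poly.
apply: (@poly_reducible_run _ _ (PComp p_combine (PPair PId p))
  (fun n => q n + q_combine (n + q n + 1) + 14)%N); first by solve_polybound.
move=> O I solO instI; have [run_p le_p] := p_ok O I solO instI.
have [zs opt_zs fold_zs] := optimal_answersP solO instI.
rewrite fold_zs -/(enc_seq (enc_pair eY eC) zs) in run_p le_p.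
have [run_combine le_combine] := combine_ok O (I, zs).
pose e_zs := enc_pair (@enc_instance A) (enc_seq (enc_pair eY eC)).
have run_input : run O (PPair PId p) (enc_instance I) = e_zs (I, zs).
  by rewrite /= run_p.
rewrite run_comp run_time_comp run_input run_combine.
split; last exact: combine_optimal.
set n := data_len (enc_instance I) in le_p *.
have le_len : (data_len (e_zs (I, zs)) <= n + q n + 1)%N.
  by rewrite /= -/n; lia.
have le_q := bound_combine.1 _ _ le_len; rewrite -/e_zs in le_combine.
have -> : run_time O (PPair PId p) (enc_instance I) =
    (run_time O p (enc_instance I) + 13)%N by rewrite /=; lia.
by lia.
Qed.

End NonadaptiveReduction.

(** * Optimal schedules are short *)

Definition sched_feasible (J : jobs) (S : schedule J) : Prop :=
  no_overlap S /\ forall j, rdate j <= S j.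

Definition sched_optimal (J : jobs) (S : schedule J) : Prop :=
  sched_feasible S /\
  forall S' : schedule J,
    sched_feasible S' -> weighted_completion S <= weighted_completion S'.

Definition enc_jobs (J : jobs) : data :=
  enc_seq (fun j => enc_list (enc_job j)) (enum 'I_(njobs J)).

Definition enc_schedule (J : jobs) (S : schedule J) : data :=
  enc_seq (fun j => Num (S j)) (enum 'I_(njobs J)).

Definition schedule_len_bound (n : nat) : nat := (1 + n * (2 * n + 2))%N.

Section OptimalSchedule.

Variables (J : jobs) (S : schedule J).

Hypothesis ptime_gt0 : forall j : 'I_(njobs J), 0 < ptime j.
Hypothesis weight_gt0 : forall j : 'I_(njobs J), 0 < weight j.
Hypothesis optS : sched_optimal S.

Lemma start_lt_completion j : S j < completion S j.
Proof. by rewrite ltrDl. Qed.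

Definition earliest_start (j : 'I_(njobs J)) : rat :=
  \big[Order.max/rdate j]_(i | (i != j) && (completion S i <= S j))
    completion S i.

Definition restart (j : 'I_(njobs J)) (t : rat) : schedule J :=
  fun i => if i == j then t else S i.

Lemma earliest_start_attained j :
  earliest_start j = rdate j \/
  exists2 i, completion S i <= S j & earliest_start j = completion S i.
Proof.
rewrite /earliest_start; elim/big_rec: _ => [|i y /andP[_ le_i] IH].
  by left.
have [_|_] := leP (completion S i) y; first exact: IH.
by right; exists i.
Qed.

Lemma earliest_start_le j : earliest_start j <= S j.
Proof.
have [_ relS] := optS.1.
by case: (earliest_start_attained j) => [->|[i le_i ->]].
Qed.

Lemma completion_le_earliest_start i j :
  i != j -> completion S i <= S j -> completion S i <= earliest_start j.
Proof. by move=> ij le_ij; apply: le_bigmax_cond; rewrite ij. Qed.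

Lemma restart_earliest_feasible j :
  sched_feasible (restart j (earliest_start j)).
Proof.
have [[noS relS] _] := optS; set t := earliest_start j.
have completion_restart : completion (restart j t) j <= completion S j.
  by rewrite /completion /restart eqxx lerD2r earliest_start_le.
split=> [i k ik|i]; last first.
  by rewrite /restart; case: eqP => [->|_] //; exact: bigmax_ge_id.
have other l : l != j ->
    restart j t l = S l /\ completion (restart j t) l = completion S l.
  by move=> /negPf lj; rewrite /completion /restart lj.
have before_j l : l != j -> completion S l <= S j \/ completion S j <= S l ->
    completion S l <= t \/ completion (restart j t) j <= S l.
  move=> lj [le_l|le_j]; [left; exact: completion_le_earliest_start | right].
  exact: le_trans le_j.
have restart_j : restart j t j = t by rewrite /restart eqxx.
case: (eqVneq i j) => [ij|/[dup] ij /other[-> ->]].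
  rewrite ij restart_j; have kj : k != j by rewrite eq_sym -ij.
  have [-> ->] := other k kj.
  by case: (before_j k kj (noS k j kj)); [right | left].
case: (eqVneq k j) => [->|/other[-> ->]]; last exact: noS.
by rewrite restart_j; exact: before_j (noS i j ij).
Qed.

(* A job preceded by idle time could be started earlier. *)
Lemma earliest_start_optimal j : earliest_start j = S j.
Proof.
apply/eqP; rewrite eq_le earliest_start_le leNgt; apply/negP => lt_j.
have := optS.2 _ (restart_earliest_feasible j); rewrite leNgt => /negP[].
rewrite /weighted_completion (bigD1 j) //= [X in _ < X](bigD1 j) //=.
rewrite (eq_bigr (fun i => weight i * completion S i)); last first.
  by move=> i /negPf ij; rewrite /completion /restart ij.
by rewrite ltrD2r ltr_pM2l // /completion /restart eqxx ltrD2r.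
Qed.

Lemma optimal_start j :
  S j = rdate j \/ exists2 i, S i < S j & S j = completion S i.
Proof.
rewrite -{1 3}(earliest_start_optimal j).
case: (earliest_start_attained j) => [->|[i le_i ->]]; first by left.
by right; exists i => //; apply: lt_le_trans le_i; exact: start_lt_completion.
Qed.

Lemma rat_len_start j :
  (rat_len (S j) <=
   \sum_k rat_len (@rdate J k) + \sum_(k | (S k < S j)%R) rat_len (ptime k))%N.
Proof.
have [n] := ubnP #|[set k | S k < S j]|; elim: n j => // n IH j lt_n.
have [->|[i lt_ij S_j]] := optimal_start j.
  by apply: leq_trans (leq_addr _ _); rewrite (bigD1 j) //= leq_addr.
have fewer : [set k | S k < S i] \proper [set k | S k < S j].
  apply/properP; split; last by exists i; rewrite !inE ?ltxx.
  by apply/subsetP => k; rewrite !inE => /lt_trans; apply.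
have le_i := IH i (leq_trans (proper_card fewer) lt_n).
rewrite {1}S_j; apply: leq_trans (rat_lenD _ _) _.
rewrite [X in (_ <= _ + X)%N](bigD1 i) //= [(rat_len (ptime i) + _)%N]addnC.
rewrite addnA leq_add2r; apply: leq_trans le_i _; rewrite leq_add2l.
rewrite big_mkcond [X in (_ <= X)%N]big_mkcond /=; apply: leq_sum => k _.
case: ifP => // lt_ki; rewrite (lt_trans lt_ki lt_ij) /=.
by case: eqP lt_ki => // ->; rewrite ltxx.
Qed.

Lemma data_len_optimal :
  (data_len (enc_schedule S) <= schedule_len_bound (data_len (enc_jobs J)))%N.
Proof.
set n := data_len (enc_jobs J); have n_sum : n = (\sum_(j < njobs J)
    (data_len (enc_list (enc_job j))).+1).+1.
  by rewrite /n data_len_seq big_enum.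
have sum_le (P : pred 'I_(njobs J)) F :
    (forall j, F j <= data_len (enc_list (enc_job j)))%N ->
    (\sum_(j | P j) F j <= n)%N.
  move=> le_F; rewrite n_sum big_mkcond ltnW // ltnS; apply: leq_sum => j _.
  by case: ifP => // _; apply: leqW.
have le_rdates : (\sum_k rat_len (@rdate J k) <= n)%N.
  by apply: sum_le => j /=; lia.
have le_ptimes j : (\sum_(k | (S k < S j)%R) rat_len (@ptime J k) <= n)%N.
  by apply: sum_le => k /=; lia.
have le_njobs : (njobs J <= n)%N.
  by have := sum_le predT (fun=> 1%N); rewrite sum1_card card_ord; apply=> j.
rewrite data_len_seq big_enum /schedule_len_bound /= add1n ltnS.
apply: leq_trans (_ : \sum_(j < njobs J) (2 * n + 2) <= _)%N; last first.
  by rewrite sum_nat_const card_ord leq_mul2r le_njobs orbT.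
apply: leq_sum => j _; have := rat_len_start j; have := le_ptimes j; lia.
Qed.

End OptimalSchedule.

Lemma classical_short_optima tau : short_optima (classical_problem tau).
Proof.
exists schedule_len_bound.
  by rewrite /schedule_len_bound; solve_polybound.
move=> J S [pos _] optS.
by apply: (data_len_optimal (S := S)) => // j; case: (pos j).
Qed.

(** * Replenishing only at release dates *)

Section RoundDown.

Variables (s : seq rat) (y : rat).

(* Without an element of [s] below [y] the result is [y] itself. *)
Definition round_down : rat := last y [seq x <- s | x <= y].

Lemma round_down_le : round_down <= y.
Proof.
rewrite /round_down; have := mem_last y [seq x <- s | x <= y].
by rewrite inE mem_filter => /predU1P[->|/andP[]].
Qed.

Lemma round_down_mem x : x \in s -> x <= y -> round_down \in s.
Proof.
move=> xs xy; have : x \in [seq x <- s | x <= y] by rewrite mem_filter xy.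
rewrite /round_down => x_in.
have: last y [seq x <- s | x <= y] \in [seq x <- s | x <= y].
  by case: [seq x <- s | x <= y] x_in => //= z l _; exact: mem_last.
by rewrite mem_filter => /andP[].
Qed.

Lemma le_round_down x :
  sorted <=%R s -> x \in s -> x <= y -> x <= round_down.
Proof.
move=> sorted_s xs xy; rewrite /round_down.
have : x \in [seq x <- s | x <= y] by rewrite mem_filter xy.
have : sorted <=%R [seq x <- s | x <= y] by apply: sorted_filter le_trans _ _ _.
move: [seq _ <- _ | _] => l sorted_l x_l.
rewrite -nth_last -(nth_index y x_l).
have lt_x : (index x l < size l)%N by rewrite index_mem.
have lt_last : ((size l).-1 < size l)%N by rewrite (ltn_predK lt_x).
apply: (sorted_leq_nth le_trans le_refl y sorted_l); rewrite ?inE //.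
by rewrite -ltnS (ltn_predK lt_x).
Qed.

End RoundDown.

Lemma mem_bigcup_seq (U : Type) (V : finType) (l : seq U) (P : pred U)
    (F : U -> {set V}) i :
  (i \in \bigcup_(x <- l | P x) F x) = has (fun x => P x && (i \in F x)) l.
Proof.
rewrite -big_has_cond.
by apply: (big_morph (fun A : {set V} => i \in A)) => [A B|]; rewrite inE.
Qed.

Definition dates (s : nat) (Q : replenishment s) : seq rat :=
  [seq x.2 | x <- Q].

Definition release_calendar (J : jobs) : seq rat := sort <=%R (release_dates J).

Lemma rdate_calendar (J : jobs) (j : 'I_(njobs J)) :
  rdate j \in release_calendar J.
Proof. by rewrite mem_sort mem_undup map_f ?mem_enum. Qed.

Lemma release_calendar_sorted J : sorted <%R (release_calendar J).
Proof. by rewrite sort_lt_sorted undup_uniq. Qed.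

Definition full_replenishment (s : nat) (J : jobs) : replenishment s :=
  [seq (setT, t) | t <- release_calendar J].

Lemma dates_full s J : dates (full_replenishment s J) = release_calendar J.
Proof. by rewrite /dates -map_comp map_id. Qed.

Lemma full_ready s (I : jrp_data s) (j : 'I_(njobs I)) t :
  rdate j <= t -> ready (full_replenishment s I) j t.
Proof.
move=> le_t; apply/subsetP => i _; rewrite mem_bigcup_seq.
apply/hasP; exists (setT, rdate j); last by rewrite /= lexx le_t in_setT.
by apply/mapP; exists (rdate j) => //; exact: rdate_calendar.
Qed.

Section Normalise.

Variables (s : nat) (I : jrp_data s).
Hypothesis cost0_ge0 : 0 <= cost0 I.
Hypothesis res_cost_ge0 : forall i, 0 <= res_cost I i.

Definition set_cost (A : {set 'I_s}) : rat :=
  cost0 I + \sum_(i in A) res_cost I i.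

Lemma set_cost_ge0 A : 0 <= set_cost A.
Proof. by rewrite addr_ge0 ?sumr_ge0. Qed.

Lemma sum_res_cost_setU (A B : {set 'I_s}) :
  \sum_(i in A :|: B) res_cost I i
  <= \sum_(i in A) res_cost I i + \sum_(i in B) res_cost I i.
Proof.
rewrite big_mkcond [X in _ <= X + _]big_mkcond [X in _ <= _ + X]big_mkcond.
rewrite -big_split; apply: ler_sum => i _ /=; rewrite inE.
have := res_cost_ge0 i.
by case: (i \in A); case: (i \in B) => /=; lra.
Qed.

Lemma set_cost_bigcup (Q : replenishment s) (P : pred ({set 'I_s} * rat)) :
  has P Q ->
  set_cost (\bigcup_(x <- Q | P x) x.1) <= \sum_(x <- Q | P x) set_cost x.1.
Proof.
have sum_bigcup (Q' : replenishment s) :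
    \sum_(i in \bigcup_(x <- Q' | P x) x.1) res_cost I i
    <= \sum_(x <- Q' | P x) set_cost x.1.
  elim: Q' => [|y Q' IH]; first by rewrite !big_nil big_set0.
  rewrite !big_cons; case: ifP => // _.
  apply: le_trans (sum_res_cost_setU _ _) (lerD _ IH).
  by rewrite /set_cost lerDr.
elim: Q => // x Q IH /=; rewrite !big_cons; case: ifP => //= Px _.
apply: le_trans (lerD (lexx _) (sum_bigcup Q)).
by rewrite /set_cost -addrA lerD2l sum_res_cost_setU.
Qed.

Variable Q : replenishment s.

Let calendar := release_calendar I.
Let rounds_to t (x : {set 'I_s} * rat) := round_down calendar x.2 == t.

Definition merge_at_releases : replenishment s :=
  [seq (\bigcup_(x <- Q | rounds_to t x) x.1, t)
     | t <- calendar & has (rounds_to t) Q].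

Lemma dates_merge :
  dates merge_at_releases = [seq t <- calendar | has (rounds_to t) Q].
Proof. by rewrite /dates -map_comp map_id. Qed.

Lemma merge_sorted : sorted <%R (dates merge_at_releases).
Proof.
rewrite dates_merge.
exact: (sorted_filter lt_trans _ (release_calendar_sorted I)).
Qed.

Lemma merge_ready (j : 'I_(njobs I)) t :
  ready Q j t -> ready merge_at_releases j t.
Proof.
move=> /subsetP sub_Q; apply/subsetP => i /sub_Q; rewrite !mem_bigcup_seq.
case/hasP => x xQ /andP[/andP[le_x x_le] ix].
have r_cal : rdate j \in calendar := rdate_calendar j.
pose u := round_down calendar x.2.
have le_round : rdate j <= u.
  by apply: le_round_down => //; exact: sort_le_sorted.
apply/hasP; exists (\bigcup_(z <- Q | rounds_to u z) z.1, u).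
  apply: (map_f (fun t => (\bigcup_(z <- Q | rounds_to t z) z.1, t))).
  rewrite mem_filter (round_down_mem r_cal le_x) andbT.
  by apply/hasP; exists x => //; exact: eqxx.
rewrite /= le_round (le_trans (round_down_le _ _) x_le) mem_bigcup_seq.
by apply/hasP; exists x => //; rewrite ix /rounds_to eqxx.
Qed.

Lemma merge_cost :
  replenishment_cost I merge_at_releases <= replenishment_cost I Q.
Proof.
rewrite /replenishment_cost big_map big_filter.
apply: (@le_trans _ _
  (\sum_(t <- calendar) \sum_(x <- Q | rounds_to t x) set_cost x.1)).
  rewrite big_mkcond; apply: ler_sum => t _; case: ifP => [hasQ|_].
    exact: set_cost_bigcup hasQ.
  by apply: sumr_ge0 => x _; exact: set_cost_ge0.
rewrite (exchange_big_dep xpredT) //=; apply: ler_sum => x _.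
rewrite /rounds_to; under eq_bigl do rewrite eq_sym.
have [in_cal|notin_cal] := boolP (round_down calendar x.2 \in calendar).
  rewrite -big_filter filter_pred1_uniq ?big_seq1 //.
  exact: lt_sorted_uniq (release_calendar_sorted I).
rewrite big1_seq ?set_cost_ge0 // => t /andP[/eqP-> t_cal].
by rewrite t_cal in notin_cal.
Qed.

End Normalise.

(** * Release dates induced by a replenishment structure *)

Definition supplied (s : nat) (Q : replenishment s) (r : rat)
    (D : {set 'I_s}) (t : rat) : bool :=
  D \subset \bigcup_(x <- Q | r <= x.2 <= t) x.1.

Definition supply_date (s : nat) (Q : replenishment s) (r : rat)
    (D : {set 'I_s}) : rat :=
  head r [seq x.2 | x <- Q & supplied Q r D x.2].

Section SupplyDate.

Variables (s : nat) (Q : replenishment s) (r : rat) (D : {set 'I_s}).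

Lemma suppliedP t :
  reflect
    (forall i, i \in D -> exists2 x, x \in Q & (r <= x.2 <= t) && (i \in x.1))
    (supplied Q r D t).
Proof.
apply: (iffP subsetP) => sub_D i /sub_D; rewrite mem_bigcup_seq.
  by move/hasP.
by move=> ?; apply/hasP.
Qed.

Lemma supplied_le t u : t <= u -> supplied Q r D t -> supplied Q r D u.
Proof.
move=> le_tu /suppliedP sup_t; apply/suppliedP => i /sup_t[x xQ].
case/andP=> /andP[rx xt] ix; exists x => //.
by rewrite rx ix (le_trans xt).
Qed.

Hypothesis sortedQ : sorted <%R (dates Q).
Hypothesis D_neq0 : D != set0.

Lemma supplied_attained t :
  supplied Q r D t -> exists2 x, x \in Q & supplied Q r D x.2 && (x.2 <= t).
Proof.
move=> /suppliedP sup_t; pose u := round_down (dates Q) t.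
have [i /sup_t[x xQ /andP[/andP[_ x_le] _]]] := set0Pn _ D_neq0.
have /mapP[y yQ u_y] : u \in dates Q.
  by apply: round_down_mem x_le; exact: map_f.
exists y => //; rewrite -u_y round_down_le andbT.
apply/suppliedP => k /sup_t[z zQ /andP[/andP[rz zt] kz]]; exists z => //.
rewrite rz kz andbT /= le_round_down // ?map_f //.
by move: sortedQ; rewrite lt_sorted_uniq_le => /andP[].
Qed.

Lemma supply_dateP t :
  has (fun x => supplied Q r D x.2) Q ->
  supplied Q r D t = (supply_date Q r D <= t).
Proof.
rewrite has_filter /supply_date => some_date.
have sorted_dates :
    sorted <%R [seq x.2 | x <- Q & supplied Q r D x.2].
  apply: subseq_sorted lt_trans _ _ _ sortedQ.
  exact: map_subseq (filter_subseq _ _).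
have date_mem x : (x \in [seq x <- Q | supplied Q r D x.2]) =
    supplied Q r D x.2 && (x \in Q) by rewrite mem_filter.
move: [seq x <- Q | _] some_date sorted_dates date_mem => [//|y l] _.
move=> /= /(order_path_min lt_trans)/allP y_min date_mem.
apply/idP/idP => [/supplied_attained[x xQ /andP[sup_x x_le]]|]; last first.
  move/supplied_le; apply.
  by have := date_mem y; rewrite mem_head => /esym/andP[].
apply: le_trans x_le; have := date_mem x; rewrite sup_x xQ inE.
by case/predU1P => [->//|x_l]; apply/ltW/y_min/map_f.
Qed.

Lemma supply_date_mem : supply_date Q r D \in r :: dates Q.
Proof.
rewrite /supply_date; have := filter_subseq (fun x => supplied Q r D x.2) Q.
case: [seq x <- Q | _] => [|y l] sub; first exact: mem_head.
by rewrite inE [X in _ || X]map_f ?orbT // (mem_subseq sub) ?mem_head.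
Qed.

End SupplyDate.

Definition induced_jobs (s : nat) (I : jrp_data s) (Q : replenishment s) :
    jobs :=
  Jobs (@ptime I) (fun j => supply_date Q (rdate j) (required j)) (@weight I).

Definition covers (s : nat) (I : jrp_data s) (Q : replenishment s) : bool :=
  all (fun j => has (fun x => ready Q j x.2) Q) (enum 'I_(njobs I)).

Lemma ready_schedule_induced (s : nat) (I : jrp_data s) Q (S : schedule I) :
  (forall j : 'I_(njobs I), required j != set0) -> sorted <%R (dates Q) ->
  (forall j : 'I_(njobs I), ready Q j (S j)) <->
  covers I Q /\ forall j : 'I_(njobs (induced_jobs I Q)), rdate j <= S j.
Proof.
move=> req sortedQ; split=> [rdy|[/allP cov rel] j].
  have cov : covers I Q.
    apply/allP => j _; apply/hasP.
    have [x xQ /andP[sup_x _]] := supplied_attained sortedQ (req j) (rdy j).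
    by exists x.
  split=> // j; rewrite /= -(supply_dateP sortedQ (req j)); first exact: rdy.
  by apply: (allP cov); rewrite mem_enum.
have some_date := cov j (mem_enum _ _).
rewrite -[ready _ _ _]/(supplied Q (rdate j) (required j) (S j)).
by rewrite supply_dateP //; exact: rel.
Qed.

Lemma induced_jobs_valid s tau (I : jrp_data s) Q :
  valid_jobs tau I -> {subset dates Q <= release_calendar I} ->
  valid_jobs tau (induced_jobs I Q).
Proof.
move=> [pos few_dates] dates_Q.
have release (j : 'I_(njobs I)) :
    supply_date Q (rdate j) (required j) \in release_calendar I.
  have := supply_date_mem Q (rdate j) (required j).
  by rewrite inE => /predU1P[->|/dates_Q]; [exact: rdate_calendar|].
split=> [j|].
  have [p0 _ w0] := pos j; split=> //=.
  have := release j; rewrite mem_sort mem_undup => /mapP[k _ ->].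
  by case: (pos k).
apply: leq_trans few_dates; apply: uniq_leq_size; first exact: undup_uniq.
move=> x; rewrite mem_undup => /mapP[j _ ->].
by have := release j; rewrite mem_sort.
Qed.

(** * Candidate replenishment structures *)

Section Structures.

Variables (s tau : nat) (I : jrp_data s).

Definition release_grid : seq ({set 'I_s} * rat) :=
  [seq (A, rdate j) | A <- enum {set 'I_s}, j <- enum 'I_(njobs I)].

Definition structures : seq (replenishment s) :=
  [seq Q <- chains (relpre snd <%R) tau release_grid | covers I Q].

Hypothesis vI : valid_jobs tau I.

Lemma mem_structures Q :
  Q \in structures =
  [&& covers I Q, sorted <%R (dates Q) & all [in release_calendar I] (dates Q)].
Proof.
rewrite mem_filter mem_chains; last by move=> ? ? ?; exact: lt_trans.
rewrite -sorted_map -/(dates Q); congr (_ && _).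
have -> : all [in release_grid] Q = all [in release_calendar I] (dates Q).
  rewrite all_map; apply: eq_all => -[A t] /=.
  rewrite mem_sort mem_undup; apply/allpairsP/mapP.
    by case=> -[B j] [_ j_I [_ ->]]; exists j.
  by case=> j j_I ->; exists (A, j); rewrite mem_enum.
have [sorted_Q|] := boolP (sorted _ (dates Q)); rewrite ?andbF //.
have [/allP cal_Q|] := boolP (all _ (dates Q)); rewrite ?andbF //= andbT.
rewrite -(size_map snd); apply: leq_trans (uniq_leq_size _ cal_Q) _.
  exact: lt_sorted_uniq.
by rewrite size_sort; case: vI.
Qed.

Lemma full_structure : full_replenishment s I \in structures.
Proof.
rewrite mem_structures dates_full release_calendar_sorted allss !andbT.
apply/allP => j _; apply/hasP; exists (setT, rdate j).
  by apply: map_f; exact: rdate_calendar.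
exact: full_ready.
Qed.

Lemma merge_structure Q :
  covers I (merge_at_releases I Q) -> merge_at_releases I Q \in structures.
Proof.
move=> cov; rewrite mem_structures cov merge_sorted dates_merge /=.
by apply/allP => t; rewrite mem_filter => /andP[].
Qed.

End Structures.

(** * Programs for the joint replenishment problem *)

Section Programs.

Variable s : nat.

Definition enc_jrp_job (I : jrp_data s) (j : 'I_(njobs I)) : data :=
  enc_list (rcons (enc_job j) (enc_set (required j))).

Definition enc_jrp (I : jrp_data s) : data :=
  Pair (enc_seq (@enc_jrp_job I) (enum 'I_(njobs I)))
    (Pair (Num (cost0 I)) (enc_seq (fun i => Num (res_cost I i)) (enum 'I_s))).

Definition enc_step : {set 'I_s} * rat -> data := enc_pair (@enc_set s) Num.

Definition enc_repl : replenishment s -> data := enc_seq enc_step.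

Lemma polydec_supplied (X : Type) (enc : X -> data) Q r D t :
  polytime enc (fun x => enc_repl (Q x)) ->
  polytime enc (fun x => Num (r x)) ->
  polytime enc (fun x => enc_set (D x)) ->
  polytime enc (fun x => Num (t x)) ->
  polydec enc (fun x => supplied (Q x) (r x) (D x) (t x)).
Proof.
move=> Q_poly r_poly D_poly t_poly; pose step (_ : X) := enc_step.
have step_poly := polytime_tagged enc step.
have supply i : polydec enc (fun x =>
    has (fun y : {set 'I_s} * rat => (r x <= y.2 <= t x) && (i \in y.1)) (Q x)).
  apply: (polydec_has (eY := step) Q_poly); apply: polydec_and.
    apply: polydec_and.
      exact: polydec_le (polytime_tag _ r_poly) (polytime_snd step_poly).
    exact: polydec_le (polytime_snd step_poly) (polytime_tag _ t_poly).
  exact: polydec_in_set (polytime_fst step_poly).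
apply: eq_polytime (polydec_forall
  (fun i => polydec_implies (polydec_in_set i D_poly) (supply i))) => x.
congr of_bool; apply/forallP/suppliedP => sup i.
  by move=> iD; have := sup i; rewrite iD => /hasP.
by apply/implyP => /sup ?; apply/hasP.
Qed.

Lemma polytime_supply_date (X : Type) (enc : X -> data) Q r D :
  polytime enc (fun x => enc_repl (Q x)) ->
  polytime enc (fun x => Num (r x)) ->
  polytime enc (fun x => enc_set (D x)) ->
  polytime enc (fun x => Num (supply_date (Q x) (r x) (D x))).
Proof.
move=> Q_poly r_poly D_poly; apply: (polytime_head _ r_poly).
pose step (_ : X) := enc_step.
apply: (polytime_map (eZ := fun=> Num) (polytime_filter (eY := step) Q_poly _)).
  apply: (polydec_supplied (polytime_tag step Q_poly) (polytime_tag step r_poly)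
    (polytime_tag step D_poly)).
  exact: polytime_snd (polytime_tagged _ _).
exact: polytime_snd (polytime_tagged _ _).
Qed.

(* The constant [\sum_j weight j * ptime j] is dropped from the cost. *)
Definition objective (I : jrp_data s) (z : seq rat * replenishment s) : rat :=
  dot [seq weight j | j <- enum 'I_(njobs I)] z.1 + replenishment_cost I z.2.

Section JobLoops.

Variables (X : Type) (enc : X -> data) (I : X -> jrp_data s).

Hypothesis I_poly : polytime enc (fun x => enc_jrp (I x)).

Let job_item := enc_item enc (fun x => @enc_jrp_job (I x)).

Lemma polytime_jobs :
  polytime enc (fun x => enc_seq (@enc_jrp_job (I x)) (enum 'I_(njobs (I x)))).
Proof. exact: polytime_fst I_poly. Qed.

Lemma polytime_ptime : polytime job_item (fun w => Num (ptime (tagged w))).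
Proof. exact: polytime_fst (polytime_tagged _ _). Qed.

Lemma polytime_rdate : polytime job_item (fun w => Num (rdate (tagged w))).
Proof. exact: polytime_fst (polytime_snd (polytime_tagged _ _)). Qed.

Lemma polytime_weight : polytime job_item (fun w => Num (weight (tagged w))).
Proof.
exact: polytime_fst (polytime_snd (polytime_snd (polytime_tagged _ _))).
Qed.

Lemma polytime_required :
  polytime job_item (fun w => enc_set (required (tagged w))).
Proof.
exact: polytime_fst (polytime_snd (polytime_snd (polytime_snd
  (polytime_tagged _ _)))).
Qed.

Lemma polytime_weights :
  polytime enc (fun x =>
    enc_seq Num [seq weight j | j <- enum 'I_(njobs (I x))]).
Proof.
exact: (polytime_map (eZ := fun=> Num) polytime_jobs polytime_weight).
Qed.

Variable Q : X -> replenishment s.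

Hypothesis Q_poly : polytime enc (fun x => enc_repl (Q x)).

Let Q_item_poly := polytime_tag (fun x => @enc_jrp_job (I x)) Q_poly.

Lemma polytime_induced_jobs :
  polytime enc (fun x => enc_jobs (induced_jobs (I x) (Q x))).
Proof.
have release_poly :=
  polytime_supply_date Q_item_poly polytime_rdate polytime_required.
have job_poly := polytime_pair polytime_ptime (polytime_pair release_poly
  (polytime_pair polytime_weight (polytime_const _ Nil))).
pose job x (j : 'I_(njobs (I x))) :=
  enc_list (@enc_job (induced_jobs (I x) (Q x)) j).
apply: eq_polytime
  (polytime_map (eZ := fun=> id) (g := job) polytime_jobs job_poly) => x.
by rewrite /enc_seq map_id.
Qed.

Lemma polydec_covers : polydec enc (fun x => covers (I x) (Q x)).
Proof.
apply: (polydec_all polytime_jobs).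
apply: (polydec_has (eY := fun=> enc_step) Q_item_poly).
apply: (polydec_supplied (polytime_tag _ Q_item_poly)
  (polytime_tag _ polytime_rdate) (polytime_tag _ polytime_required)).
exact: polytime_snd (polytime_tagged _ _).
Qed.

Lemma polytime_replenishment_cost :
  polytime enc (fun x => Num (replenishment_cost (I x) (Q x))).
Proof.
apply: (polytime_sum Q_poly); pose step (_ : X) := enc_step.
have costs_poly := polytime_snd (polytime_tag step I_poly).
have set_poly := polytime_fst (polytime_tagged enc step).
pose res_costs (w : {_ : X & {set 'I_s} * rat}) :=
  [seq res_cost (I (tag w)) i | i <- enum 'I_s].
pose members (w : {_ : X & {set 'I_s} * rat}) : seq rat :=
  [seq (i \in (tagged w).1)%:R | i <- enum 'I_s].
have res_poly : polytime (enc_item enc step)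
    (fun w => enc_seq Num (res_costs w)).
  apply: eq_polytime (polytime_snd costs_poly) => w.
  by rewrite /enc_seq -map_comp.
have mem_poly : polytime (enc_item enc step) (fun w => enc_seq Num (members w)).
  by apply: eq_polytime set_poly => w; rewrite /enc_seq -map_comp.
apply: eq_polytime (polytime_add (polytime_fst costs_poly)
  (polytime_dot res_poly mem_poly)) => w /=; congr (Num (_ + _)).
rewrite /dot zip_map big_map big_enum [RHS]big_mkcond.
by apply: eq_bigr => i _ /=; case: ifP; rewrite ?mulr1 ?mulr0.
Qed.

Variable ys : X -> seq rat.

Hypothesis ys_poly : polytime enc (fun x => enc_seq Num (ys x)).

Lemma polytime_objective :
  polytime enc (fun x => Num (objective (I x) (ys x, Q x))).
Proof.
exact: polytime_add (polytime_dot polytime_weights ys_poly)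
  polytime_replenishment_cost.
Qed.

End JobLoops.

Lemma polytime_structures tau :
  polytime enc_jrp (fun I => enc_seq enc_repl (structures tau I)).
Proof.
have I_poly := polytime_id enc_jrp.
have grid_poly : polytime enc_jrp
    (fun I => enc_seq enc_step (release_grid I)).
  have sets_poly :
      polytime enc_jrp (fun=> enc_seq (@enc_set s) (enum {set 'I_s})).
    exact: polytime_const.
  apply: (polytime_flatmap sets_poly (eZ := fun=> enc_step)).
  have I_poly' := polytime_tag (fun=> @enc_set s) I_poly.
  apply: (polytime_map (eZ := fun=> enc_step) (polytime_jobs I_poly')).
  exact: polytime_pair (polytime_tag _ (polytime_tagged _ _))
    (polytime_rdate _ _).
have chains_poly := polytime_chains (r := relpre snd <%R) tau _ grid_poly.
apply: (polytime_filter (eY := fun=> enc_repl) (chains_poly _)).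
  apply: polydec_lt.
    exact: polytime_on_fst (polytime_snd (polytime_id _)).
  exact: polytime_on_snd (polytime_snd (polytime_id _)).
have Q_poly := polytime_tagged enc_jrp (fun=> enc_repl).
exact: (polydec_covers (polytime_tag (fun=> enc_repl) I_poly) Q_poly).
Qed.

Definition enc_answer : seq rat * replenishment s -> data :=
  enc_pair (enc_seq Num) enc_repl.

Definition best_answer (I : jrp_data s)
    (zs : seq (seq rat * replenishment s)) : seq rat * replenishment s :=
  argmin_seq (objective I) (head ([::], [::]) zs) zs.

Lemma polytime_best_answer :
  polytime (enc_pair enc_jrp (enc_seq enc_answer))
    (fun x => enc_answer (best_answer x.1 x.2)).
Proof.
have I_poly := polytime_on_fst (enc_seq enc_answer) (polytime_id enc_jrp).
have zs_poly := polytime_on_snd enc_jrp (polytime_id (enc_seq enc_answer)).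
have default_poly := polytime_const (enc_pair enc_jrp (enc_seq enc_answer))
  (enc_answer ([::], [::])).
apply: (polytime_argmin zs_poly (polytime_head zs_poly default_poly)).
pose item (_ : jrp_data s * seq (seq rat * replenishment s)) := enc_answer.
have z_poly := polytime_tagged (enc_pair enc_jrp (enc_seq enc_answer)) item.
apply: eq_polytime (polytime_objective (polytime_tag item I_poly)
  (Q := fun w => (tagged w).2) (polytime_snd z_poly)
  (ys := fun w => (tagged w).1) (polytime_fst z_poly)) => w.
by rewrite -surjective_pairing.
Qed.

End Programs.

(** * The two reductions *)

Definition start_times (J : jobs) (S : schedule J) : seq rat :=
  [seq S j | j <- enum 'I_(njobs J)].

Lemma weighted_completionE (J : jobs) (S : schedule J) :
  weighted_completion S
  = dot [seq weight j | j <- enum 'I_(njobs J)] (start_times S)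
    + \sum_(j < njobs J) weight j * ptime j.
Proof.
rewrite /dot zip_map big_map big_enum /= -big_split.
by apply: eq_bigr => j _; rewrite /completion mulrDr.
Qed.

Section JrpToClassical.

Variables (s tau : nat).

Lemma jrp_cost_objective (I : jrp_data s) (S : schedule I) Q :
  @cost (jrp_problem s tau) I (S, Q)
  = objective I (start_times S, Q) + \sum_(j < njobs I) weight j * ptime j.
Proof. by rewrite /= weighted_completionE addrAC. Qed.

Section BestAnswer.

Variables (I : jrp_data s) (zs : seq (seq rat * replenishment s)).

Hypothesis vI : valid_jrp tau I.
Hypothesis answers :
  @optimal_answers (jrp_problem s tau) (classical_problem tau) _ _ start_times
    (structures tau) (@induced_jobs s) I zs.

Lemma best_answer_mem : best_answer I zs \in zs.
Proof.
have [vJ _ _ _] := vI; have [dom_zs _] := answers.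
have : full_replenishment s I \in [seq z.2 | z <- zs].
  by rewrite dom_zs full_structure.
rewrite /best_answer; case: zs => // z l _.
have [+ _] := argmin_seqP (objective I) z (z :: l).
by rewrite inE => /predU1P[->|//]; exact: mem_head.
Qed.

Lemma best_answer_le z :
  z \in zs -> objective I (best_answer I zs) <= objective I z.
Proof.
move=> z_in; have [_] := argmin_seqP (objective I) (head ([::], [::]) zs) zs.
by apply; rewrite inE z_in orbT.
Qed.

Lemma answer_le_cost (S : schedule I) Q :
  @feasible (jrp_problem s tau) I (S, Q) ->
  exists2 z, z \in zs & objective I z <= objective I (start_times S, Q).
Proof.
move=> [/= noS _ rdy]; have [vJ req cost0_ge0 res_cost_ge0] := vI.
have [dom_zs opt_zs] := answers.
set Q' := merge_at_releases I Q.
have [cov relS] := (ready_schedule_induced S req (merge_sorted I Q)).1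
  (fun j => merge_ready (rdy j)).
have /mapP[[y Q''] z_in /= Q'_z] : Q' \in [seq z.2 | z <- zs].
  by rewrite dom_zs merge_structure.
rewrite -Q'_z in z_in; exists (y, Q') => //.
have [S' [_ optS'] <-] := opt_zs _ _ z_in.
have := optS' S (conj noS relS).
rewrite /= !weighted_completionE lerD2r => le_starts.
exact: lerD le_starts (merge_cost cost0_ge0 res_cost_ge0 Q).
Qed.

Lemma best_answer_optimal :
  @encodes_optimal (jrp_problem s tau) I (enc_answer (best_answer I zs)).
Proof.
have [_ req _ _] := vI; have [dom_zs opt_zs] := answers.
have := best_answer_le; have := best_answer_mem.
case: (best_answer I zs) => y Q z_in z_le.
have Q_in : Q \in structures tau I by rewrite -dom_zs; exact: (map_f snd z_in).
have [cov sorted_Q] : covers I Q /\ sorted <%R (dates Q).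
  have [vJ _ _ _] := vI.
  by move: Q_in; rewrite mem_structures // => /and3P[].
have [S [[noS relS] _] y_S] := opt_zs _ _ z_in.
exists (S, Q); last first.
  by rewrite -y_S /= /enc_answer /enc_pair /= /start_times /enc_seq -map_comp.
split=> [|[S2 Q2] /answer_le_cost[z /z_le]].
  split=> //=.
  exact: (ready_schedule_induced S req sorted_Q).2 (conj cov relS).
rewrite -y_S !jrp_cost_objective lerD2r; exact: le_trans.
Qed.

End BestAnswer.

Theorem jrp_reduces_to_classical :
  poly_reducible (jrp_problem s tau) (classical_problem tau).
Proof.
apply: (@nonadaptive_reduction (jrp_problem s tau) (classical_problem tau)
  _ _ (@enc_repl s) (enc_seq Num) start_times (structures tau)
  (@induced_jobs s) (fun I zs => enc_answer (best_answer I zs))).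
- by move=> J S; rewrite /start_times /enc_seq -map_comp.
- exact: classical_short_optima.
- exact: polytime_structures.
- have I_poly := polytime_on_fst (@enc_repl s) (polytime_id (@enc_jrp s)).
  have Q_poly := polytime_on_snd (@enc_jrp s) (polytime_id (@enc_repl s)).
  exact: (polytime_induced_jobs I_poly Q_poly).
- exact: polytime_best_answer.
- move=> I Q [vJ _ _ _]; rewrite mem_structures // => /and3P[_ _ /allP].
  exact: induced_jobs_valid.
- exact: best_answer_optimal.
Qed.

End JrpToClassical.

Section ClassicalToJrp.

Variables (s tau : nat) (hs : (0 < s)%N).

Definition free_jrp (J : jobs) : jrp_data s :=
  @JrpData s J (fun=> setT) 0 (fun=> 0).

Lemma free_jrp_valid (J : jobs) :
  valid_jobs tau J -> valid_jrp tau (free_jrp J).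
Proof. by move=> vJ; split=> //= j; apply/set0Pn; exists (Ordinal hs). Qed.

Lemma free_jrp_optimal (J : jobs)
    (x : @solution (jrp_problem s tau) (free_jrp J)) :
  optimal x -> sched_optimal (J := J) x.1.
Proof.
have cost_free Q : replenishment_cost (free_jrp J) Q = 0.
  by apply: big1 => y _; rewrite add0r; apply: big1.
move=> [[noS _ rdy] opt]; split.
  split=> // j; have := rdy j => /subsetP/(_ (Ordinal hs) (in_setT _)).
  rewrite mem_bigcup_seq => /hasP[y _ /andP[/andP[le_y y_le] _]].
  exact: le_trans y_le.
move=> S' [noS' relS'].
have := opt (S', full_replenishment s J); rewrite /= !cost_free !addr0; apply.
split=> //= [|j]; last exact: (full_ready (I := free_jrp J)).
by rewrite -/(dates _) dates_full release_calendar_sorted.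
Qed.

Lemma polytime_free_jrp :
  polytime enc_jobs (fun J => enc_jrp (free_jrp J)).
Proof.
pose eJ (J : jobs) (j : 'I_(njobs J)) := enc_list (enc_job j).
have jobs_poly :
    polytime enc_jobs (fun J => enc_seq (@eJ J) (enum 'I_(njobs J))).
  exact: polytime_id.
have j_poly := polytime_tagged enc_jobs eJ.
have job_poly := polytime_pair (polytime_fst j_poly)
  (polytime_pair (polytime_fst (polytime_snd j_poly))
  (polytime_pair (polytime_fst (polytime_snd (polytime_snd j_poly)))
    (polytime_const _ (Pair (enc_set [set: 'I_s]) Nil)))).
have list_poly := polytime_map (eZ := fun=> id)
  (g := fun J => @enc_jrp_job s (free_jrp J)) jobs_poly job_poly.
have costs_poly := polytime_const enc_jobs
  (Pair (Num 0) (enc_seq (fun _ : 'I_s => Num 0) (enum 'I_s))).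
apply: eq_polytime (polytime_pair list_poly costs_poly) => J.
by rewrite /enc_jrp /enc_seq map_id.
Qed.

Theorem classical_reduces_to_jrp :
  poly_reducible (classical_problem tau) (jrp_problem s tau).
Proof.
have [p [q bound_q p_ok]] := polytime_free_jrp.
apply: (@poly_reducible_run _ _ (PComp PFst (PComp PAsk p))
  (fun n => 3 * q n + schedule_len_bound n + 7)%N).
  by rewrite /schedule_len_bound; solve_polybound.
move=> O J solO vJ.
have [[pos _] [x opt_x ans_x]] := (vJ, solO _ (free_jrp_valid vJ)).
have opt_S := free_jrp_optimal opt_x.
have [run_p le_q] := p_ok O J.
have run_J : run O (PComp PFst (PComp PAsk p)) (enc_jobs J) = enc_schedule x.1.
  by rewrite !run_comp run_p [run _ PAsk _]ans_x.
have le_S : (data_len (enc_schedule x.1)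
    <= schedule_len_bound (data_len (enc_jobs J)))%N.
  by apply: data_len_optimal => // j; case: (pos j).
rewrite -[enc_instance J]/(enc_jobs J) run_J; split; last by exists x.1.
rewrite !run_time_comp run_p; move: (enc_jrp (free_jrp J)) le_q => d le_q.
rewrite [X in (_ <= X)%N]addnAC; apply: leq_add le_S.
by have := data_size_leq_len d; rewrite /=; lia.
Qed.

End ClassicalToJrp.

Theorem theorem1 (s tau : nat) (hs : (0 < s)%N) :
  equivalent (jrp_problem s tau) (classical_problem tau).
Proof.
by split; [exact: jrp_reduces_to_classical | exact: classical_reduces_to_jrp].
Qed.
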